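(* Let $m,n$ be non-negative integers with $n>m$. Let $m_1,n_1,m_2,n_2$ be non-negative integers with $m_1+n_1=m_2+n_2$ and $|m_1-n_1|<|m_2-n_2|$. Let $M$ and $N$ be any lists (possibly empty). Then (1) $\beta(M,m,n)\ge\beta(M,n,m)$, with equality if $M$ is empty; (2) $\beta(M,m_1,n_1,N)>\beta(M,m_2,n_2,N)$.
   Context: A list $(p_1,\dots,p_r)$ of non-negative integers ($r\ge1$) denotes the word $\mathbf c^{p_1}\mathbf d\mathbf c^{p_2}\mathbf d\cdots\mathbf d\mathbf c^{p_r}$ in non-commuting variables $\mathbf c$ (degree 1), $\mathbf d$ (degree 2); commas denote concatenation of lists. For a graded poset $P$ of rank $r+1$ with $\hat0,\hat1$ and $S\subseteq[r]$, $f_S$ counts chains $\hat0<x_1<\dots<x_j<\hat1$ with rank set $S$, $h_S=\sum_{T\subseteq S}(-1)^{|S-T|}f_T$, and the ab-index is $\sum_S h_S u_1\cdots u_r$ with $u_i=\mathbf b$ if $i\in S$, $\mathbf a$ otherwise. For Eulerian $P$ it is uniquely a polynomial $\Psi(P)$ in $\mathbf c=\mathbf a+\mathbf b$, $\mathbf d=\mathbf a\mathbf b+\mathbf b\mathbf a$. $B_{r+1}$ is the Boolean lattice of subsets of $[r+1]$. For a word $v$ of degree $r$, $\beta(v)$ is the coefficient of $v$ in $\Psi(B_{r+1})$; $\beta$ of a list is $\beta$ of the word it denotes. *)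

(* Defs.v *)
From HB Require Import structures.
From Stdlib Require Import ClassicalEpsilon.
From mathcomp Require Import all_boot all_order all_algebra.
From mathcomp Require Import finmap.
From mathcomp.multinomials Require Import monalg.

Set Implicit Arguments.
Unset Strict Implicit.
Unset Printing Implicit Defensive.

Import Order.TTheory Order.DefaultSetSubsetOrder GRing.Theory Num.Theory.
Local Open Scope ring_scope.

(* The free ring on two non-commuting letters.  The letters are booleans:
   (false, true) stands for (a, b) in ab-polynomials, and for (c, d) in
   cd-polynomials. *)
Definition ncpoly := {malg int[{fmonom bool}]}.

Definition ncvar (x : bool) : ncpoly := << FMonom [:: x] >>.

Section AbIndex.
Context {disp : Order.disp_t} {P : finTBPOrderType disp}.

(* Length of a longest chain of the interval [\bot, x]; in a graded poset this
   is the rank of x. *)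
Definition rank (x : P) : nat :=
  (\max_(C : {set P} | [forall y in C, (y <= x)%O] &&
                       [forall y in C, forall z in C, (y >=< z)%O]) #|C|).-1.

(* A subset S of [r] is encoded as a set of ordinals i < r, with i standing for
   the rank i + 1; enum lists it in increasing order. *)
Definition flag_f (r : nat) (S : {set 'I_r}) : nat :=
  #|[set x : #|S|.-tuple P | path <%O \bot%O (rcons x \top%O) &
       [seq rank y | y <- x] == [seq (val i).+1 | i <- enum S]]|.

Definition flag_h (r : nat) (S : {set 'I_r}) : int :=
  \sum_(T : {set 'I_r} | T \subset S) (-1) ^+ #|S :\: T| * (flag_f T)%:Z.

End AbIndex.

Definition ab_index (disp : Order.disp_t) (P : finTBPOrderType disp) : ncpoly :=
  let r := (rank (\top%O : P)).-1 in
  \sum_(S : {set 'I_r}) flag_h (P := P) S *: \prod_(i < r) ncvar (i \in S).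

(* The ab-polynomial obtained by c := a + b and d := ab + ba. *)
Definition cd_eval (F : ncpoly) : ncpoly :=
  let a := ncvar false in
  let b := ncvar true in
  let c := a + b in
  let d := a * b + b * a in
  \sum_(w <- msupp F) F@_w *: \prod_(x <- (w : seq bool)) (if x then d else c).

(* The unique cd-polynomial representing the ab-index; it exists when P is
   Eulerian, and is unspecified if there is none. *)
Definition cd_index (disp : Order.disp_t) (P : finTBPOrderType disp) : ncpoly :=
  epsilon (inhabits 0) (fun F : ncpoly => cd_eval F = ab_index P).

Definition cd_degree (v : seq bool) : nat :=
  \sum_(x <- v) (if x then 2 else 1)%N.

Definition boolean_lattice (n : nat) : finTBPOrderType _ := {set 'I_n}.

Definition cd_coef_boolean (v : seq bool) : int :=
  (cd_index (boolean_lattice (cd_degree v).+1))@_(FMonom v).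

Fixpoint cd_word (s : seq nat) : seq bool :=
  match s with
  | [::] => [::]
  | [:: p] => nseq p false
  | p :: s' => nseq p false ++ true :: cd_word s'
  end.

Definition beta (s : seq nat) : int := cd_coef_boolean (cd_word s).

(* Main.v *)
(** Let [b v := beta v / (|v| + 1)!] with [|v|] the degree of a cd-word [v].  If
    [X] is the exponential generating function of the ab-indices of the Boolean
    lattices, counting flags by their lowest element gives [X = e + e b X] with
    [e' = 1 + (a - b) e], hence [X' = (1 + X a)(1 + b X) = (1 + X b)(1 + a X)].
    Differentiating, [X'' = (c + X d) X'], which shows by induction that [X] is
    a cd-series; adding the two expressions of [X'] and comparing coefficients,
    [2 (|v| + 1) b v = 2 [v = 1] + [v = c w] b w + [v = w c] b w
       + sum_(v = x d y) b x b y].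
    Everything else follows from this recursion.

    For a word [Z], the numbers [w_i = b (c^i d Z)] are
    [w_i = (mu_1 - mu_(i+2)) / (i + 2)!], where the [mu_i] are the moments of a
    positive measure on [[0, 1]] that is symmetric under [x -> 1 - x]; in terms
    of the recursion, the mixed moments of [x^j (1 - x)^k] solve a linear system
    that obeys a minimum principle.  This gives [1/(i+3) < w_(i+1)/w_i], and
    [w_(i+1)/w_i <= 1/(i+2)] follows directly from the recursion.  The numbers
    [b (c^m d c^n d Z)] with fixed [m + n] are explicit alternating sums of the
    [w_i]; rewriting these sums with mixed moments makes
    [b (c^m d c^n d Z) > b (c^(n+1) d c^(m-1) d Z)], for [1 <= m <= n], a
    termwise comparison of binomial coefficients.  Together with (1), which
    follows by induction from the recursion, this orders all the
    [b (c^m d c^n d Z)].  When both [M] and [N] are nonempty, (2) is proved by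
    induction: the recursion only involves shorter instances of (2), the case
    where [M] or [N] is empty, and the products
    [b (A d c^m) b (c^n d Z)], which are ordered by the bounds on
    [w_(i+1)/w_i]. *)

From Stdlib Require Import ClassicalEpsilon FunctionalExtensionality.
Require Import Defs.
From mathcomp Require Import all_boot all_order all_algebra.
From mathcomp Require Import ring lra zify.
From mathcomp.multinomials Require Import monalg.

Set Implicit Arguments.
Unset Strict Implicit.
Unset Printing Implicit Defensive.

Import Order.TTheory Order.DefaultSetSubsetOrder GRing.Theory Num.Theory.
Local Open Scope ring_scope.

(** * The recursion and its consequences *)

Lemma cd_degree_nil : cd_degree [::] = 0%N.
Proof. by rewrite /cd_degree big_nil. Qed.

Lemma cd_degree_cons x v : cd_degree (x :: v) = ((if x then 2 else 1) + cd_degree v)%N.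
Proof. by rewrite /cd_degree big_cons. Qed.

Lemma cd_degree_cat u v : cd_degree (u ++ v) = (cd_degree u + cd_degree v)%N.
Proof. by rewrite /cd_degree big_cat. Qed.

Lemma cd_degree_rev v : cd_degree (rev v) = cd_degree v.
Proof. by rewrite /cd_degree (perm_big v) //= perm_rev. Qed.

Lemma cd_degree_nseq n : cd_degree (nseq n false) = n.
Proof. by elim: n => [|n IHn] /=; rewrite ?cd_degree_nil // cd_degree_cons IHn. Qed.

Definition cd_degreeE :=
  (cd_degree_nil, cd_degree_cons, cd_degree_cat, cd_degree_rev, cd_degree_nseq).

(** Certificates for linear consequences: the multipliers of known equations are given by hand, and
    an identity for [ring] or [field] remains. *)
Lemma lin_comb1 (a p q x y : rat) :
  p = q -> x - y = a * (p - q) -> x = y.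
Proof. by move=> -> /eqP; rewrite subrr mulr0 subr_eq0 => /eqP. Qed.

Lemma lin_comb2 (a a' p q p' q' x y : rat) :
  p = q -> p' = q' -> x - y = a * (p - q) + a' * (p' - q') -> x = y.
Proof. by move=> -> -> /eqP; rewrite !subrr !mulr0 addr0 subr_eq0 => /eqP. Qed.

Lemma lin_combD (p q p' q' : rat) : p = q -> p' = q' -> p + p' = q + q'.
Proof. by move=> -> ->. Qed.

Lemma lin_combZ (a p q : rat) : p = q -> a * p = a * q.
Proof. by move=> ->. Qed.

Arguments lin_combZ a {p q}.
Arguments lin_comb1 a {p q x y}.
Arguments lin_comb2 a a' {p q p' q' x y}.

Lemma pascal_sum (V : nmodType) (f : nat -> V) n :
  \sum_(i < n.+2) f i *+ 'C(n.+1, i) = \sum_(i < n.+1) (f i + f i.+1) *+ 'C(n, i).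
Proof.
under [RHS]eq_bigr do rewrite mulrnDl.
rewrite big_split /= [LHS]big_ord_recl bin0.
under [X in _ + X = _]eq_bigr do rewrite lift0 binS mulrnDr.
rewrite big_split /= addrA; congr (_ + _).
by rewrite big_ord_recr /= bin_small // mulr0n addr0 [RHS]big_ord_recl bin0.
Qed.

(** * Sums over factorizations of a word *)

Section SplitSums.
Context {R : numDomainType}.
Implicit Types (f g : seq bool -> R) (u v : seq bool).

(* The sum of [f x * g y] over the factorizations [v = x d y]. *)
Fixpoint dsplit f g v : R :=
  if v is x :: v' then
    (if x then f [::] * g v' else 0) + dsplit (fun u => f (x :: u)) g v'
  else 0.

Definition lstrip f v : R := if v is false :: v' then f v' else 0.

Definition rstrip f v : R := lstrip (fun u => f (rev u)) (rev v).

Lemma eq_dsplit f f' g g' v :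
    (forall u, (size u < size v)%N -> f u = f' u) ->
    (forall u, (size u < size v)%N -> g u = g' u) ->
  dsplit f g v = dsplit f' g' v.
Proof.
elim: v f f' => //= x v IHv f f' eqf eqg.
congr (_ + _); first by case: x eqf eqg => // eqf eqg; rewrite eqf ?eqg.
by apply: IHv => u ltuv; [apply: eqf | apply: eqg; apply: ltnW].
Qed.

Lemma eq_lstrip f f' v :
  (forall u, (size u < size v)%N -> f u = f' u) -> lstrip f v = lstrip f' v.
Proof. by case: v => [|[] v] //= eqf; apply: eqf. Qed.

Lemma eq_rstrip f f' v :
  (forall u, (size u < size v)%N -> f u = f' u) -> rstrip f v = rstrip f' v.
Proof.
by move=> eqf; apply: eq_lstrip => u; rewrite size_rev => ltu; rewrite eqf ?size_rev.
Qed.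

Lemma dsplit_cat f g u v :
  dsplit f g (u ++ v) =
    dsplit f (fun y => g (y ++ v)) u + dsplit (fun x => f (u ++ x)) g v.
Proof. by elim: u f => [|x u IHu] f /=; rewrite ?add0r // IHu addrA. Qed.

Lemma dsplit_ge0 f g v :
    (forall u, (size u < size v)%N -> 0 <= f u) ->
    (forall u, (size u < size v)%N -> 0 <= g u) ->
  0 <= dsplit f g v.
Proof.
elim: v f => //= x v IHv f f0 g0; apply: addr_ge0.
  by case: x f0 => // f0; rewrite mulr_ge0 ?f0 ?g0.
by apply: IHv => u ltuv; [apply: f0 | apply: g0; apply: ltnW].
Qed.

Lemma lstrip_ge0 f v :
  (forall u, (size u < size v)%N -> 0 <= f u) -> 0 <= lstrip f v.
Proof. by case: v => [|[] v] //= f0; apply: f0. Qed.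

Lemma rstrip_ge0 f v :
  (forall u, (size u < size v)%N -> 0 <= f u) -> 0 <= rstrip f v.
Proof.
by move=> f0; apply: lstrip_ge0 => u; rewrite size_rev => ltu; rewrite f0 ?size_rev.
Qed.

Lemma dsplitDl f f' g a v :
  dsplit (fun u => f u + a * f' u) g v = dsplit f g v + a * dsplit f' g v.
Proof.
elim: v f f' => [|x v IHv] f f' /=; first by rewrite mulr0 addr0.
by rewrite IHv; case: x; ring.
Qed.

Lemma dsplitDr f g g' a v :
  dsplit f (fun u => g u + a * g' u) v = dsplit f g v + a * dsplit f g' v.
Proof.
elim: v f => [|x v IHv] f /=; first by rewrite mulr0 addr0.
by rewrite IHv; case: x; ring.
Qed.

Lemma lstripD f f' a v :
  lstrip (fun u => f u + a * f' u) v = lstrip f v + a * lstrip f' v.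
Proof. by case: v => [|[] v] /=; rewrite ?mulr0 ?addr0. Qed.

Lemma rstripD f f' a v :
  rstrip (fun u => f u + a * f' u) v = rstrip f v + a * rstrip f' v.
Proof. exact: lstripD. Qed.

Lemma dsplit_rcons f g v x :
  dsplit f g (rcons v x) =
    dsplit f (fun y => g (rcons y x)) v + (if x then f v * g [::] else 0).
Proof.
rewrite -cats1 dsplit_cat /= addr0 cats0; congr (_ + _).
by apply: eq_dsplit => // u _; rewrite cats1.
Qed.

Lemma dsplit_rev f g v :
  dsplit f g (rev v) = dsplit (fun u => g (rev u)) (fun u => f (rev u)) v.
Proof.
elim: v g => [|x v IHv] g //=; rewrite rev_cons dsplit_rcons IHv addrC.
congr (_ + _); first by case: x => //; rewrite mulrC.
by apply: eq_dsplit => // u _; rewrite rev_cons.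
Qed.

Lemma lstrip_rev f v : lstrip f (rev v) = rstrip (fun u => f (rev u)) v.
Proof. by apply: eq_lstrip => u _; rewrite revK. Qed.

Lemma rstrip_rev f v : rstrip f (rev v) = lstrip (fun u => f (rev u)) v.
Proof. by rewrite /rstrip revK. Qed.

Lemma lstrip_join f u v :
  lstrip f (u ++ true :: v) = lstrip (fun y => f (y ++ true :: v)) u.
Proof. by case: u. Qed.

Lemma rstrip_join f u v :
  rstrip f (u ++ true :: v) = rstrip (fun x => f (u ++ true :: x)) v.
Proof.
rewrite /rstrip rev_cat rev_cons cat_rcons lstrip_join.
by apply: eq_lstrip => y _; rewrite rev_cat rev_cons revK cat_rcons.
Qed.

Lemma dsplit_nseq f g n : dsplit f g (nseq n false) = 0.
Proof. by elim: n f => //= n IHn f; rewrite IHn addr0. Qed.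

End SplitSums.

(** * Positivity, reversal and comparison principles *)

Section NormalizedCoefficients.
(** An arbitrary solution of the recursion; [nbeta] is shown to be one at the end. *)
Variable b : seq bool -> rat.
Hypothesis b_rec : forall v,
  2 * (cd_degree v).+1%:R * b v =
    (if v is [::] then 2 else 0) + lstrip b v + rstrip b v + dsplit b b v.

Lemma b_nil : b [::] = 1.
Proof. by have := b_rec [::]; rewrite cd_degree_nil /rstrip /= mulr1 => h; lra. Qed.

(** No term of the recursion is negative, and one is positive: the constant 2 for the empty word,
    otherwise the term that removes the first letter. *)
Lemma b_gt0 v : 0 < b v.
Proof.
have [n] := ubnP (size v); elim: n v => // n IHn [|x v] /= lt_n.
  by rewrite b_nil.
have IH u : (size u < size (x :: v))%N -> 0 <= b u.
  by move=> ltu; apply/ltW/IHn/(leq_trans ltu).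
have bv : 0 < b v by apply: IHn.
have r0 : 0 <= rstrip b (x :: v) by apply: rstrip_ge0.
suff: 0 < 2 * (cd_degree (x :: v)).+1%:R * b (x :: v) by rewrite pmulr_rgt0 // mulr_gt0.
rewrite b_rec add0r; case: x lt_n IH r0 => lt_n IH r0 /=.
  rewrite b_nil mul1r add0r -addrCA ltr_wpDr // addr_ge0 //.
  by apply: dsplit_ge0 => u ltu; apply: IH => //; apply: ltnW.
rewrite -addrA ltr_wpDr // add0r addr_ge0 //.
by apply: dsplit_ge0 => u ltu; apply: IH => //; apply: ltnW.
Qed.

(** Reversal exchanges the two strip terms and the two factors of each split, so it preserves the
    recursion. *)
Lemma b_rev v : b (rev v) = b v.
Proof.
have [n] := ubnP (size v); elim: n v => // n IHn v lt_n.
have IH u : (size u < size v)%N -> b (rev u) = b u.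
  by move=> ltu; apply: IHn; apply: leq_trans ltu _.
have nz : 2 * (cd_degree v).+1%:R != 0 :> rat by rewrite mulf_neq0 ?pnatr_eq0.
apply: (mulfI nz); rewrite -{1}cd_degree_rev !b_rec lstrip_rev rstrip_rev dsplit_rev.
rewrite (eq_rstrip IH) (eq_lstrip IH) (eq_dsplit IH IH).
have -> : (if rev v is [::] then 2 else 0) = (if v is [::] then 2 else 0) :> rat.
  by case: v {lt_n IH nz} => //= x v; rewrite rev_cons; case: (rev v).
by rewrite -!addrA; congr (_ + _); rewrite addrCA.
Qed.

(** The terms of the recursion that cut a word inside its right-hand block [Z]; [f] holds the
    context on the left. [lpeel] is the mirror image. *)
Definition rpeel (f : seq bool -> rat) Z := rstrip f Z + dsplit f b Z.
Definition lpeel (f : seq bool -> rat) A := lstrip f A + dsplit b f A.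

Lemma rpeelD f g a Z : rpeel (fun x => f x + a * g x) Z = rpeel f Z + a * rpeel g Z.
Proof. by rewrite /rpeel rstripD dsplitDl; ring. Qed.

Lemma lpeelD f g a Z : lpeel (fun x => f x + a * g x) Z = lpeel f Z + a * lpeel g Z.
Proof. by rewrite /lpeel lstripD dsplitDr; ring. Qed.

Lemma eq_rpeel f g Z :
  (forall u, (size u < size Z)%N -> f u = g u) -> rpeel f Z = rpeel g Z.
Proof. by move=> eqfg; congr (_ + _); [apply: eq_rstrip | apply: eq_dsplit]. Qed.

Lemma rpeel_ge0 f Z :
  (forall u, (size u < size Z)%N -> 0 <= f u) -> 0 <= rpeel f Z.
Proof.
move=> f0; rewrite addr_ge0 ?rstrip_ge0 ?dsplit_ge0 // => u _.
exact/ltW/b_gt0.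
Qed.

Lemma lpeel_ge0 f Z :
  (forall u, (size u < size Z)%N -> 0 <= f u) -> 0 <= lpeel f Z.
Proof.
move=> f0; rewrite addr_ge0 ?lstrip_ge0 ?dsplit_ge0 // => u _.
exact/ltW/b_gt0.
Qed.

(** The terms are sorted by the place of the cut: inside [A], at the displayed [d], or inside
    [Z]. *)
Lemma b_join A Z :
  2 * (cd_degree A + cd_degree Z + 3)%:R * b (A ++ true :: Z) =
    lpeel (fun y => b (y ++ true :: Z)) A + b A * b Z +
    rpeel (fun x => b (A ++ true :: x)) Z.
Proof.
have := b_rec (A ++ true :: Z).
rewrite lstrip_join rstrip_join dsplit_cat /= cats0 !cd_degreeE.
have -> : (cd_degree A + (2 + cd_degree Z)).+1 = (cd_degree A + cd_degree Z + 3)%N by lia.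
move=> ->; rewrite /lpeel /rpeel.
have -> : (if A ++ true :: Z is [::] then 2 else 0) = 0 :> rat by case: (A).
ring.
Qed.

(** [rpeel f Z] combines values of [f] at shorter words with nonnegative weights, so a nonnegative
    source [g] keeps [f] nonnegative. It is applied below to differences. *)
Lemma peel_ind f g (c : seq bool -> rat) :
    (forall Z, 0 < c Z) -> (forall Z, c Z * f Z = rpeel f Z + g Z) ->
    (forall Z, 0 <= g Z) -> forall Z, 0 <= f Z.
Proof.
move=> c0 eqf g0 Z; have [n] := ubnP (size Z); elim: n Z => // n IHn Z lt_n.
rewrite -(pmulr_rge0 _ (c0 Z)) eqf addr_ge0 // rpeel_ge0 // => u ltu.
by apply: IHn; apply: leq_trans ltu _.
Qed.

(** * The words [c^i d Z] *)

Definition b_cd i Z := b (nseq i false ++ true :: Z).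
Definition b_cd_pred i Z := if i is i'.+1 then b_cd i' Z else 0.
Definition lstart Z : rat := (if Z is [::] then 2 else 0) + lstrip b Z.

Lemma lstart_ge0 Z : 0 <= lstart Z.
Proof. by rewrite addr_ge0 ?lstrip_ge0 // => [|u _]; [case: Z | exact/ltW/b_gt0]. Qed.

Lemma b_lstart Z : 2 * (cd_degree Z).+1%:R * b Z = rpeel b Z + lstart Z.
Proof. by rewrite b_rec /rpeel /lstart; ring. Qed.

Lemma b_nseq i : b (nseq i false) = (i.+1)`!%:R^-1.
Proof.
elim: i => [|i IHi]; first by rewrite b_nil invr1.
have := b_rec (nseq i.+1 false); rewrite dsplit_nseq cd_degree_nseq.
have -> : rstrip b (nseq i.+1 false) = b (nseq i false).
  by rewrite /rstrip rev_nseq /= rev_nseq.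
rewrite /= IHi [(i.+2)`!]factS natrM invfM => h.
have nz : i.+2%:R != 0 :> rat by rewrite pnatr_eq0.
apply: (mulfI nz); rewrite mulrA divff // mul1r; lra.
Qed.

Lemma b_cd_gt0 i Z : 0 < b_cd i Z.
Proof. exact: b_gt0. Qed.

Lemma b_cd_rec i Z :
  2 * (cd_degree Z + i + 3)%:R * b_cd i Z =
    b_cd_pred i Z + rpeel (b_cd i) Z + b Z / (i.+1)`!%:R.
Proof.
have := b_join (nseq i false) Z; rewrite -/(b_cd i Z) cd_degree_nseq [(i + _)%N]addnC => ->.
rewrite b_nseq /lpeel dsplit_nseq addr0 [rpeel _ Z]/(rpeel (b_cd i) Z).
by case: i => [|i] /=; rewrite /b_cd /=; ring.
Qed.

Lemma rpeelB f g Z : rpeel (fun x => f x - g x) Z = rpeel f Z - rpeel g Z.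
Proof.
rewrite -[RHS]/(rpeel f Z + - rpeel g Z) -mulN1r -rpeelD.
by apply: eq_rpeel => u _; rewrite mulN1r.
Qed.

Lemma rpeelZ f a Z : rpeel (fun x => a * f x) Z = a * rpeel f Z.
Proof.
have := rpeelD (fun _ => 0) f a Z.
have -> : rpeel (fun=> 0) Z = 0.
  have := rpeelD (fun _ => 0) (fun _ => 0) (-1) Z.
  rewrite (@eq_rpeel _ (fun=> 0)) => [h|u _]; [lra | by rewrite mulr0 addr0].
by rewrite add0r => <-; apply: eq_rpeel => u _; rewrite add0r.
Qed.

(** [peel_ind] for [f] and [-f]. A linear identity follows once the difference of its sides solves a
    source-free equation. *)
Lemma peel_eq0 f (c : seq bool -> rat) :
    (forall Z, 0 < c Z) -> (forall Z, c Z * f Z = rpeel f Z) ->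
  forall Z, f Z = 0.
Proof.
move=> c0 eqf Z; apply/eqP; rewrite eq_le; apply/andP; split; last first.
  by apply: (@peel_ind f (fun _ => 0) c) => // x; rewrite addr0.
rewrite -oppr_ge0.
apply: (@peel_ind (fun x => - f x) (fun _ => 0) c) => // x; rewrite addr0.
rewrite mulrN eqf -mulN1r -rpeelZ.
by apply: eq_rpeel => u _; rewrite mulN1r.
Qed.

Lemma natr_gt0 n : 0 < n.+1%:R :> rat.
Proof. by rewrite ltr0n. Qed.

Lemma b_cd0E Z : b_cd 0 Z = 2 * b_cd 1 Z.
Proof.
apply/eqP; rewrite -subr_eq0; apply/eqP; move: Z.
apply: (@peel_eq0 _ (fun Z => 2 * (cd_degree Z + 4)%:R)) => Z.
  by rewrite mulr_gt0 // ltr0n addn4.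
rewrite rpeelB rpeelZ.
(* The multiples of [b Z] cancel, and the term [-2 w_0] raises the factor of [w_0] from
   [2 (|Z| + 3)] to [2 (|Z| + 4)]. *)
apply: (lin_comb2 1 (-2) (b_cd_rec 0 Z) (b_cd_rec 1 Z)).
by rewrite /b_cd_pred (_ : 1`! = 1%N) // (_ : 2`! = 2%N) //; field.
Qed.

(** In the equation for [w_(i+1) - (i+3) w_(i+2)] the multiples of [b Z] cancel. The source left is
    [(w_i - (i+2) w_(i+1)) + w_(i+1)], nonnegative by induction. *)
Lemma b_cd_upper i Z : i.+2%:R * b_cd i.+1 Z <= b_cd i Z.
Proof.
rewrite -subr_ge0; elim: i Z => [|i IHi] Z.
  by rewrite b_cd0E subrr.
apply: (@peel_ind (fun Z => b_cd i.+1 Z - i.+3%:R * b_cd i.+2 Z)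
  (fun Z => (b_cd i Z - i.+2%:R * b_cd i.+1 Z) + b_cd i.+1 Z)
  (fun Z => 2 * (cd_degree Z + i + 5)%:R)) => x.
- by rewrite mulr_gt0 // ltr0n addnS.
- rewrite rpeelB rpeelZ.
  have e : b x / (i.+2)`!%:R = i.+3%:R * (b x / (i.+3)`!%:R).
    by rewrite [(i.+3)`!]factS natrM invfM mulrCA mulVKf // pnatr_eq0.
  apply: (lin_comb2 1 (- i.+3%:R) (b_cd_rec i.+1 x) (b_cd_rec i.+2 x)).
  by rewrite e /b_cd_pred; ring.
- by rewrite addr_ge0 // ltW // b_cd_gt0.
Qed.

(** * Moments and mixed moments *)

Lemma factr_neq0 n : n`!%:R != 0 :> rat.
Proof. by rewrite pnatr_eq0 -lt0n fact_gt0. Qed.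

Lemma factrS n : (n.+1)`!%:R = n.+1%:R * n`!%:R :> rat.
Proof. by rewrite factS natrM. Qed.

Lemma bin_factr n k : (k <= n)%N ->
  n`!%:R = 'C(n, k)%:R * (k`!%:R * (n - k)`!%:R) :> rat.
Proof. by move=> le_kn; rewrite -(bin_fact le_kn) !natrM. Qed.

(* The moments of the measure of total mass [2 * b Z] described above; its
   symmetry forces the first moment to be [b Z]. *)
Definition moment i Z :=
  match i with
  | 0 => 2 * b Z
  | 1 => b Z
  | i'.+2 => b Z - i`!%:R * b_cd i' Z
  end.

(** For [i >= 2], subtract [i!] times the equation of [w_(i-2)] from that of [b Z]; the [b Z] term
    of the former completes [moment (i-1)]. The doubled source at [i = 0] matches the mass
    [2 b Z]. *)
Lemma moment_rec i Z :
  2 * (cd_degree Z + 1 + i)%:R * moment i Z =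
    i%:R * moment i.-1 Z + rpeel (moment i) Z + lstart Z * (1 + (i == 0%N)%:R).
Proof.
case: i => [|[|i]].
- rewrite rpeelZ; apply: (lin_comb1 2 (b_lstart Z)); rewrite /moment /=; ring.
- apply: (lin_comb1 1 (b_lstart Z)); rewrite /moment /=.
  rewrite [rpeel (fun _ => _) Z]/(rpeel b Z); ring.
- rewrite rpeelB rpeelZ.
  apply: (lin_comb2 1 (- (i.+2)`!%:R) (b_lstart Z) (b_cd_rec i Z)).
  have e : (i.+2)`!%:R * (b Z / (i.+1)`!%:R) = i.+2%:R * b Z.
    by rewrite factrS mulrCA !mulrA mulfK ?factr_neq0 // mulrC.
  have -> : i.+2%:R * moment i.+2.-1 Z =
      (i.+2)`!%:R * (b Z / (i.+1)`!%:R) - (i.+2)`!%:R * b_cd_pred i Z.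
    rewrite e; case: i {e} => [|i] /=; first by rewrite mulr0 subr0.
    by rewrite mulrBr mulrA -factrS.
  have lamE : lstart Z * (1 + (i.+2 == 0%N)%:R) = lstart Z by rewrite addr0 mulr1.
  have nE : (cd_degree Z + 1 + i.+2)%:R = (cd_degree Z).+1%:R + i.+2%:R :> rat.
    by rewrite addn1 natrD.
  have nE' : (cd_degree Z + i + 3)%:R = (cd_degree Z).+1%:R + i.+2%:R :> rat.
    by rewrite -natrD; congr _%:R; lia.
  rewrite lamE nE nE' /moment.
  move: e; move: (b Z / _) (i.+2)`!%:R => q f e; ring: e.
Qed.

(* The moment of [x^j (1 - x)^k]. *)
Fixpoint mixed_moment k j Z : rat :=
  if k is k'.+1 then mixed_moment k' j Z - mixed_moment k' j.+1 Z else moment j Z.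

(** Induction on [k], subtracting the equations at [j] and [j + 1]. The resulting system is
    symmetric in [j] and [k], which the definition does not show. *)
Lemma mixed_moment_rec k j Z :
  (2 * (cd_degree Z).+1 + j + k)%:R * mixed_moment k j Z =
    j%:R * mixed_moment k.+1 j.-1 Z + k%:R * mixed_moment k.-1 j.+1 Z + rpeel (mixed_moment k j) Z
    + lstart Z * ((j == 0%N)%:R + (k == 0%N)%:R).
Proof.
elim: k j => [|k IHk] j.
  apply: (lin_comb1 1 (moment_rec j Z)).
  by rewrite [mixed_moment 1 _ _]/= [mixed_moment 0 _ _]/=; case: j => [|j] /=; ring.
have -> : rpeel (mixed_moment k.+1 j) Z = rpeel (mixed_moment k j) Z - rpeel (mixed_moment k j.+1) Z.
  exact: (rpeelB (mixed_moment k j)).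
apply: (lin_comb2 1 (-1) (IHk j) (IHk j.+1)).
case: k {IHk} => [|k]; case: j => [|j] /=; ring.
Qed.

(* Minimum principle: at an index of fixed [k + j] where [F] is minimal, the
   right-hand side is at least [(j + k) F]. *)
Lemma moment_system_ge0 (F : nat -> nat -> seq bool -> rat)
    (g : nat -> nat -> seq bool -> rat) :
    (forall k j Z, (2 * (cd_degree Z).+1 + j + k)%:R * F k j Z =
      j%:R * F k.+1 j.-1 Z + k%:R * F k.-1 j.+1 Z + rpeel (F k j) Z + g k j Z) ->
    (forall k j Z, 0 <= g k j Z) ->
  forall k j Z, 0 <= F k j Z.
Proof.
move=> F_rec g0 k j Z; have [n] := ubnP (size Z).
elim: n k j Z => // n IHn k j Z lt_n.
pose L := (j + k)%N; pose h (i : 'I_L.+1) := F (L - i)%N i Z.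
pose i0 := [arg min_(i < ord0) h i]%O.
have hmin i : h i0 <= h i by rewrite /i0; case: arg_minP => // x _; apply.
have jL : (j < L.+1)%N by rewrite ltnS leq_addr.
suff i0_ge0 : 0 <= h i0.
  apply: le_trans i0_ge0 _; have := hmin (Ordinal jL).
  by rewrite {2}/h /= /L addKn.
have r0 : 0 <= rpeel (F (L - i0)%N i0) Z.
  by apply: rpeel_ge0 => u ltu; apply: IHn; apply: leq_trans ltu _.
have e := F_rec (L - i0)%N i0 Z.
have leL : (i0 <= L)%N by rewrite -ltnS.
(* The truncated predecessors, at [i0 = 0] here and at [i0 = L] in [l2], carry coefficient zero. *)
have l1 : i0%:R * h i0 <= i0%:R * F (L - i0).+1 i0.-1 Z.
  case: (posnP i0) => [-> | i_gt0]; first by rewrite !mul0r.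
  rewrite ler_wpM2l //.
  have lt1 : (i0.-1 < L.+1)%N by lia.
  have := hmin (Ordinal lt1); rewrite {2}/h /=.
  by have -> : (L - i0.-1 = (L - i0).+1)%N by lia.
have l2 : (L - i0)%:R * h i0 <= (L - i0)%:R * F (L - i0).-1 i0.+1 Z.
  case: (posnP (L - i0)) => [-> | i_gt0]; first by rewrite !mul0r.
  rewrite ler_wpM2l //.
  have lt1 : (i0.+1 < L.+1)%N by lia.
  have := hmin (Ordinal lt1); rewrite {2}/h /=.
  by have -> : (L - i0.+1 = (L - i0).-1)%N by lia.
rewrite -/(h i0) in e; rewrite leNgt; apply/negP => h_lt0.
have := g0 (L - i0)%N i0 Z.
have d0 : 0 < (2 * (cd_degree Z).+1)%:R :> rat by rewrite ltr0n.
rewrite -addnA natrD !mulrDl natrD mulrDl in e.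
have : (2 * (cd_degree Z).+1)%:R * h i0 < 0 by rewrite pmulr_rlt0.
lra.
Qed.

Lemma mixed_moment_ge0 k j Z : 0 <= mixed_moment k j Z.
Proof.
apply: (moment_system_ge0 mixed_moment_rec) => {}k {}j {}Z.
by rewrite mulr_ge0 ?lstart_ge0 // addr_ge0.
Qed.

(** Positivity starts from the mass [2 b Z] and spreads through the recursion, first in [j] at
    [k = 0], then in [k]. *)
Lemma mixed_moment_gt0 k j Z : 0 < mixed_moment k j Z.
Proof.
elim: k j => [|k IHk] j.
  elim: j => [|j IHj]; first by rewrite /= mulr_gt0 ?b_gt0.
  suff: 0 < 2 * (cd_degree Z + 1 + j.+1)%:R * moment j.+1 Z.
    by rewrite pmulr_rgt0 // mulr_gt0 // ltr0n addnS.
  rewrite moment_rec ltr_wpDr ?mulr_ge0 ?lstart_ge0 //.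
  rewrite ltr_wpDr ?mulr_gt0 ?ltr0n //.
  by apply: rpeel_ge0 => u _; apply: (mixed_moment_ge0 0).
suff: 0 < (2 * (cd_degree Z).+1 + j + k.+1)%:R * mixed_moment k.+1 j Z.
  by rewrite pmulr_rgt0 // ltr0n addnS.
rewrite mixed_moment_rec ltr_wpDr //; first by rewrite mulr_ge0 ?lstart_ge0 // addr_ge0.
rewrite ltr_wpDr //; first by apply: rpeel_ge0 => u _; apply: mixed_moment_ge0.
by rewrite ltr_wpDl // ?mulr_ge0 ?mulr_gt0 ?ltr0n // mixed_moment_ge0.
Qed.

(** The symmetry [x -> 1 - x]: the difference solves the homogeneous system, so the minimum
    principle makes it nonnegative for both orders of the indices. *)
Lemma mixed_momentC k j Z : mixed_moment k j Z = mixed_moment j k Z.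
Proof.
suff le k' j' : 0 <= mixed_moment k' j' Z - mixed_moment j' k' Z.
  by apply/eqP; rewrite eq_le -subr_ge0 le -subr_ge0 le.
apply: (@moment_system_ge0 (fun k j Z => mixed_moment k j Z - mixed_moment j k Z) (fun _ _ _ => 0)) => // {}k {}j {}Z.
rewrite rpeelB; apply: (lin_comb2 1 (-1) (mixed_moment_rec k j Z) (mixed_moment_rec j k Z)).
ring.
Qed.

Lemma b_cd_lower i Z : b_cd i Z < i.+3%:R * b_cd i.+1 Z.
Proof.
have e : mixed_moment 1 i.+2 Z = (i.+2)`!%:R * (i.+3%:R * b_cd i.+1 Z - b_cd i Z).
  have -> : mixed_moment 1 i.+2 Z = moment i.+2 Z - moment i.+3 Z by [].
  by rewrite /moment [(i.+3)`!%:R]factrS; ring.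
have := mixed_moment_gt0 1 i.+2 Z; rewrite e pmulr_rgt0 ?subr_gt0 //.
by rewrite ltr0n fact_gt0.
Qed.

(** One unit of [t] at a time: [w_(n+k+1)/w_(n+k)] is at most [1/(n+k+2) <= 1/(m+k+3)], hence below
    [w_(m+k+1)/w_(m+k)]. The bounds ignore the word, so [Y] and [Z] may differ. *)
Lemma b_cd_balance m n t Y Z :
  (m < n)%N -> (0 < t)%N -> b_cd m Y * b_cd (n + t) Z < b_cd (m + t) Y * b_cd n Z.
Proof.
move=> lt_mn; case: t => // t _.
have step k : b_cd m Y * b_cd (n + k) Z <= b_cd (m + k) Y * b_cd n Z ->
    b_cd m Y * b_cd (n + k.+1) Z < b_cd (m + k.+1) Y * b_cd n Z.
  move=> le_k; rewrite !addnS -(ltr_pM2l (natr_gt0 (m + k).+2)).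
  have le1 : (m + k).+3%:R * b_cd (n + k).+1 Z <= b_cd (n + k) Z.
    apply: le_trans (b_cd_upper _ _); apply: ler_wpM2r; first exact/ltW/b_cd_gt0.
    by rewrite ler_nat; lia.
  apply: (@le_lt_trans _ _ (b_cd m Y * b_cd (n + k) Z)).
    by rewrite mulrCA ler_wpM2l // ltW // b_cd_gt0.
  by apply: le_lt_trans le_k _; rewrite mulrA ltr_pM2r ?b_cd_gt0 // b_cd_lower.
apply: (step _ _); elim: t => [|t IHt]; first by rewrite !addn0.
exact/ltW/step.
Qed.

(** The integral of [x^r = x^r (x + (1 - x))^l]. *)
Lemma mixed_moment_telescope l r Z :
  \sum_(i < l.+1) mixed_moment (l - i) (r + i) Z *+ 'C(l, i) = moment r Z.
Proof.
elim: l r => [|l IHl] r; first by rewrite big_ord1 bin0 addn0.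
rewrite (pascal_sum (fun i => mixed_moment (l.+1 - i) (r + i) Z)) -IHl.
apply: eq_bigr => i _; congr (_ *+ _); have lti := ltn_ord i.
by rewrite subSS addnS subSn // [mixed_moment _.+1 _ _]/= subrK.
Qed.

Lemma lpeel_nseq f i :
  lpeel f (nseq i false) = if i is i'.+1 then f (nseq i' false) else 0.
Proof. by rewrite /lpeel dsplit_nseq addr0; case: i. Qed.

Lemma rpeel_nseq f i :
  rpeel f (nseq i false) = if i is i'.+1 then f (nseq i' false) else 0.
Proof.
by rewrite /rpeel dsplit_nseq addr0 /rstrip rev_nseq; case: i => //= i; rewrite rev_nseq.
Qed.

Lemma b_one_d m n :
  b (nseq m false ++ true :: nseq n false) =
    (((m.+1)`!%:R * (n.+1)`!%:R)^-1 - (m + n).+2`!%:R^-1) / (m + n + 3)%:R.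
Proof.
have [k] := ubnP (m + n); elim: k m n => // k IHk m n lt_k.
have := b_join (nseq m false) (nseq n false).
rewrite !cd_degree_nseq lpeel_nseq rpeel_nseq !b_nseq.
set u := (if m is m'.+1 then _ else _); set v := (if n is n'.+1 then _ else _).
(* The closed form extended to exponent -1 is 0, which covers the absent strip term at [m = 0];
   likewise for [hv]. *)
have hu : u = ((m`!%:R * (n.+1)`!%:R)^-1 - (m + n).+1`!%:R^-1) / (m + n + 2)%:R.
  rewrite /u; case: m lt_k {u v} => [|m] lt_k.
    by rewrite mul1r add0n subrr mul0r.
  by rewrite IHk; last lia; have -> : (m.+1 + n + 2 = m + n + 3)%N by lia.
have hv : v = (((m.+1)`!%:R * n`!%:R)^-1 - (m + n).+1`!%:R^-1) / (m + n + 2)%:R.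
  rewrite /v; case: n lt_k {u v hu} => [|n] lt_k.
    by rewrite mulr1 addn0 subrr mul0r.
  rewrite IHk; last lia; have -> : (m + n.+1 + 2 = m + n + 3)%N by lia.
  by rewrite (addnS m n).
rewrite hu hv => e.
have nz : 2 * (m + n + 3)%:R != 0 :> rat by rewrite mulf_neq0 // addn3 pnatr_eq0.
apply: (mulfI nz); rewrite e.
rewrite !factrS.
have h1 := factr_neq0 m; have h2 := factr_neq0 n; have h3 := factr_neq0 (m + n).
move: (m`!%:R) (n`!%:R) ((m + n)`!%:R) h1 h2 h3 => x y z x0 y0 z0.
have m0 : 0 <= m%:R :> rat by []; have n0 : 0 <= n%:R :> rat by [].
field; rewrite x0 y0 z0 /=.
by do ?[apply/andP; split]; rewrite lt0r_neq0 //; lra.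
Qed.

(** * The words [c^m d c^n d Z] *)

Definition b_cdcd m n Z := b (nseq m false ++ true :: nseq n false ++ true :: Z).

(* The value of [b_cdcd] at [m - 1], with the convention that it vanishes at [-1]. *)
Definition b_cdcd_pred m n Z := if m is m'.+1 then b_cdcd m' n Z else 0.

(** [b_cdcd_pred] at [(m + 1, n - 1)], that is [b (c^m d c^(n-1) d Z)], and 0 at [n = 0]. *)
Definition b_cdcd_succ m n Z := if n is n'.+1 then b_cdcd_pred m.+1 n' Z else 0.

Lemma b_cdcd_gt0 m n Z : 0 < b_cdcd m n Z.
Proof. exact: b_gt0. Qed.

Lemma b_cdcd_rec m n Z :
  2 * (cd_degree Z + m + n + 5)%:R * b_cdcd m n Z =
    b_cdcd_pred m n Z + b_cd n Z / (m.+1)`!%:R + b_cd m (nseq n false) * b Z + rpeel (b_cdcd m n) Z.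
Proof.
have := b_join (nseq m false ++ true :: nseq n false) Z.
rewrite !cd_degreeE -catA cat_cons -/(b_cdcd m n Z).
have -> : (m + (2 + n) + cd_degree Z + 3)%N = (cd_degree Z + m + n + 5)%N by lia.
move=> ->; congr (_ + _ + _); last by apply: eq_rpeel => u _; rewrite -catA cat_cons.
rewrite /lpeel lstrip_join dsplit_cat /= !dsplit_nseq cats0 b_nseq /b_cd.
rewrite addr0 add0r; congr (_ + _); last by rewrite mulrC.
by case: m => //= m; rewrite -catA cat_cons.
Qed.

Lemma b_cdcd_adjacent0 n Z : b_cdcd 0 n Z = b_cd n.+1 Z - 2 * b_cd n.+2 Z.
Proof.
apply/eqP; rewrite -subr_eq0; apply/eqP; move: Z.
apply: (@peel_eq0 _ (fun Z => 2 * (cd_degree Z + n + 5)%:R)) => Z.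
  by rewrite mulr_gt0 // ltr0n addnS.
rewrite !(rpeelB, rpeelZ).
apply: (lin_comb1 1 (lin_combD (b_cdcd_rec 0 n Z)
  (lin_combD (lin_combZ (-1) (b_cd_rec n.+1 Z)) (lin_combZ 2 (b_cd_rec n.+2 Z))))).
rewrite [b_cd 0 (nseq n false)]b_one_d /b_cdcd_pred /b_cd_pred !add0n (_ : 1`! = 1%N) // !factrS.
have h1 := factr_neq0 n; have n0 : 0 <= n%:R :> rat by [].
move: (n`!%:R) h1 => x x0.
field; rewrite x0 /=.
by do ?[apply/andP; split]; rewrite lt0r_neq0 //; lra.
Qed.

(** Sums of neighbours with fixed [m + n] are explicit in the [w_i]; iterating gives the alternating
    sums. *)
Lemma b_cdcd_adjacent m n Z :
  b_cdcd_pred m n Z + b_cdcd_succ m n Z = b_cd n Z / (m.+1)`!%:R - 2 * b_cd (m + n).+1 Z.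
Proof.
elim: m n Z => [|m IHm] [|n] Z.
- by rewrite /= addr0 divr1 b_cd0E subrr.
- by rewrite [LHS]/= b_cdcd_adjacent0 add0r (_ : 1`! = 1%N) // divr1.
- rewrite [LHS]/= addr0 addSn addn0; set a := (_`!%:R).
  suff /(_ Z)/eqP : forall Z, b_cdcd m 0 Z - (a^-1 * b_cd 0 Z - 2 * b_cd m.+2 Z) = 0.
    by rewrite subr_eq0 => /eqP ->; rewrite [a^-1 * _]mulrC.
  apply: (@peel_eq0 _ (fun Z => 2 * (cd_degree Z + m + 5)%:R)) => {}Z.
    by rewrite mulr_gt0 // ltr0n addnS.
  rewrite !(rpeelB, rpeelZ).
  apply: (lin_comb1 1 (lin_combD (lin_combD (b_cdcd_rec m 0 Z) (IHm 0%N Z))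
    (lin_combD (lin_combZ (- a^-1) (b_cd_rec 0 Z)) (lin_combZ 2 (b_cd_rec m.+2 Z))))).
  rewrite [b_cd m (nseq 0 false)]b_one_d /b_cdcd_succ {}/a /b_cd_pred !addn0 (_ : 1`! = 1%N) // !factrS.
  have h1 := factr_neq0 m; have m0 : 0 <= m%:R :> rat by [].
  move: (m`!%:R) h1 => x x0.
  field; rewrite x0 /=.
  by do ?[apply/andP; split]; rewrite lt0r_neq0 //; lra.
- rewrite [LHS]/= addSn addnS; set a := (_`!%:R).
  suff /(_ Z)/eqP : forall Z, (b_cdcd m n.+1 Z - a^-1 * b_cd n.+1 Z)
      - (-1 * b_cdcd m.+1 n Z - 2 * b_cd (m + n).+3 Z) = 0.
    by move=> /eqP h; apply: (lin_comb1 1 h); ring.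
  apply: (@peel_eq0 _ (fun Z => 2 * (cd_degree Z + m + n + 6)%:R)) => {}Z.
    by rewrite mulr_gt0 // ltr0n addnS.
  rewrite !(rpeelB, rpeelZ).
  (* [IHm] removes the two left strip terms, and the closed form [b_one_d] makes the multiples of
     [b Z] cancel. *)
  apply: (lin_comb1 1 (lin_combD (lin_combD (b_cdcd_rec m n.+1 Z) (b_cdcd_rec m.+1 n Z)) (lin_combD (IHm n.+1 Z)
    (lin_combD (lin_combZ (- a^-1) (b_cd_rec n.+1 Z)) (lin_combZ 2 (b_cd_rec (m + n).+3 Z)))))).
  rewrite [b_cd m (nseq n.+1 false)]b_one_d [b_cd m.+1 (nseq n false)]b_one_d.
  rewrite /b_cdcd_succ {}/a /b_cd_pred !addSn !addnS !factrS.
  have h1 := factr_neq0 m; have m0 : 0 <= m%:R :> rat by [].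
  have h2 := factr_neq0 n; have n0 : 0 <= n%:R :> rat by [].
  have h3 := factr_neq0 (m + n).
  move: (m`!%:R) (n`!%:R) ((m + n)`!%:R) h1 h2 h3 => x y z x0 y0 z0.
  field; rewrite x0 y0 z0 /=.
  by do ?[apply/andP; split]; rewrite lt0r_neq0 //; lra.
Qed.

Lemma mul_bin_trinomial r l k :
  ('C(r + l, r + k) * 'C(r + k, r) = 'C(r + l, r) * 'C(l, k))%N.
Proof.
have [le_kl | lt_lk] := leqP k l; last first.
  by rewrite (@bin_small (r + l)) ?(@bin_small l) ?ltn_add2l // muln0.
have fg0 : (0 < r`! * (k`! * (l - k)`!))%N by rewrite !muln_gt0 !fact_gt0.
apply/eqP; rewrite -(eqn_pmul2r fg0); apply/eqP.
have e1 := @bin_fact (r + l) (r + k) ltac:(by rewrite leq_add2l).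
have e2 := @bin_fact (r + k) r (leq_addr _ _).
have e3 := @bin_fact (r + l) r (leq_addr _ _).
have e4 := @bin_fact l k le_kl.
rewrite subnDl in e1; rewrite addKn in e2; rewrite addKn in e3.
transitivity (r + l)`!.
  by rewrite -e1 -e2; move: 'C(_, _) 'C(_, _) r`! k`! (l - k)`! => *; lia.
by rewrite -e3 -e4; move: 'C(_, _) 'C(_, _) r`! k`! (l - k)`! => *; lia.
Qed.

(** The hypotheses say that [p] is at least as close to [x/2] as [q]. *)
Lemma leq_bin_mirror x p q : (p <= q)%N -> (x <= p + q)%N -> ('C(x, q) <= 'C(x, p))%N.
Proof.
elim: x p q => [|x IHx] p q le_pq le_x.
  by case: q le_pq {le_x} => [|q]; rewrite ?leqn0 ?bin0n // => /eqP ->.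
have [-> // | neq_pq] := eqVneq p q.
case: q le_pq le_x neq_pq => [|q] le_pq le_x neq_pq; first by lia.
case: p le_pq le_x neq_pq => [|p] le_pq le_x neq_pq.
  by have [-> | ltq] := eqVneq x q; rewrite ?binn ?bin0 // bin_small //; lia.
by rewrite !binS addnC leq_add // IHx; lia.
Qed.

(** The alternating sums rewritten with nonnegative terms; [r] enters only through ['C(j, r)], which
    allows termwise comparison. *)
Definition altsum L r Z :=
  \sum_(j < L) mixed_moment (L - j.+1) j.+1 Z *+ ('C(L, j.+1) * 'C(j, r)).

(** The telescoping sum for [moment 0] without its first term, which symmetry turns into
    [moment L Z]. *)
Lemma altsum0 L Z : altsum L 0 Z = 2 * b Z - moment L Z.
Proof.
rewrite -[2 * b Z]/(moment 0 Z) -(mixed_moment_telescope L) big_ord_recl bin0 subn0 addn0.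
rewrite -[moment L Z]/(mixed_moment 0 L Z) mixed_momentC addrAC subrr add0r.
by apply: eq_bigr => j _; rewrite lift0 bin0 muln1 add0n.
Qed.

(** Pascal's rule merges the two sums, and [mul_bin_trinomial] reduces the result to the telescoping
    sum of [moment r.+1]. *)
Lemma altsum_pascal l r Z :
  altsum (r.+1 + l) r.+1 Z + altsum (r.+1 + l) r Z = moment r.+1 Z *+ 'C(r.+1 + l, r.+1).
Proof.
set L := (r.+1 + l)%N.
transitivity (\sum_(i < L.+1) mixed_moment (L - i) i Z *+ ('C(L, i) * 'C(i, r.+1))).
  rewrite /altsum -big_split [RHS]big_ord_recl bin0n muln0 mulr0n add0r.
  by apply: eq_bigr => j _ /=; rewrite -[bump 0 j]/(j.+1) -mulrnDr -mulnDr -binS.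
rewrite -(mixed_moment_telescope l) -sumrMnl /L -addnS big_split_ord /= [X in X + _]big1 => [|i _].
  rewrite add0r; apply: eq_bigr => i _.
  by rewrite mul_bin_trinomial subnDl -mulrnA mulnC.
by rewrite (@bin_small i) ?muln0.
Qed.

(** For fixed [m + n] both sides obey the same two-term recursion in [n]: the left by
    [b_cdcd_adjacent], the right by [step], which comes from [altsum_pascal]. *)
Lemma b_cdcd_explicit m n Z :
  (m + n + 3)`!%:R * (b_cdcd_pred m n Z + b_cd (m + n).+1 Z) =
    b Z *+ 'C(m + n + 2, n.+2) - altsum (m + n + 3) n.+2 Z.
Proof.
have step p : (p < (m + n + 3))%N ->
    b Z *+ 'C(m + n + 2, p.+1) - altsum (m + n + 3) p.+1 Z =
      (b Z - moment p.+1 Z) *+ 'C(m + n + 3, p.+1)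
      - (b Z *+ 'C(m + n + 2, p) - altsum (m + n + 3) p Z).
  move=> ltp; have := altsum_pascal (m + n + 3 - p.+1) p Z; rewrite subnKC // => e.
  apply: (lin_comb1 (-1) e); rewrite mulrnBl.
  rewrite (_ : 'C(m + n + 3, p.+1) = 'C(m + n + 2, p.+1) + 'C(m + n + 2, p))%N; last first.
    by rewrite -binS addn3 addn2.
  by rewrite !mulrnDr; ring.
(* Since [moment 1 Z = b Z], only [b Z - moment (m+n+3) Z] survives in [step] at [p = 0]. *)
have base : b Z *+ 'C(m + n + 2, 1) - altsum (m + n + 3) 1 Z
    = (m + n + 3)`!%:R * b_cd (m + n).+1 Z.
  rewrite step ?addn3 // altsum0 bin0 [moment 1 Z]/= subrr mul0rn [moment _.+3 Z]/moment; ring.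
elim: n m step base => [|n IHn] m step base.
  rewrite step ?addn3 // -addn3 base [moment 2 Z]/moment.
  have := b_cdcd_adjacent m 0 Z; rewrite /b_cdcd_succ addr0 !addn0 => ->.
  rewrite (@bin_factr (m + 3) 2) ?addn3 // -addn3 (_ : m + 3 - 2 = m.+1)%N; last by lia.
  rewrite -mulr_natr; have f2 : 2`!%:R = 2 :> rat by [].
  rewrite f2; have := factr_neq0 m.+1; move: (_`!%:R) => x x0; by field.
have IH := IHn m.+1; rewrite addSnnS in IH; have {}IH := IH step base.
rewrite step; last by lia.
apply: (lin_comb1 1 (lin_combD (lin_combZ (-1) IH) (lin_combZ (m + n.+1 + 3)`!%:R (b_cdcd_adjacent m n.+1 Z)))).
rewrite (@bin_factr (m + n.+1 + 3) n.+3); last by lia.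
rewrite (_ : m + n.+1 + 3 - n.+3 = m.+1)%N; last by lia.
rewrite -mulr_natr /b_cdcd_succ /moment.
have := factr_neq0 m.+1; move: (_.+1`!%:R) (_.+3`!%:R) => x y x0; by field.
Qed.

(** The two explicit formulas share their [w] term and, by symmetry of binomials, their multiple of
    [b Z]; only the [altsum] terms differ. *)
Lemma b_cdcd_lt_flip m n Z : (m < n)%N -> b_cdcd n.+1 m Z < b_cdcd m.+1 n Z.
Proof.
move=> lt_mn.
have e1 := b_cdcd_explicit m.+2 n Z; have e2 := b_cdcd_explicit n.+2 m Z.
have eqL : (n.+2 + m = m.+2 + n)%N by lia.
rewrite !{}eqL in e2.
have eqC : 'C(m.+2 + n + 2, n.+2) = 'C(m.+2 + n + 2, m.+2).
  by rewrite -bin_sub; [congr 'C(_, _) | ]; lia.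
suff lt : altsum (m.+2 + n + 3) n.+2 Z < altsum (m.+2 + n + 3) m.+2 Z.
  have f0 : 0 < (m.+2 + n + 3)`!%:R :> rat by rewrite ltr0n fact_gt0.
  rewrite -(ltrD2r (b_cd (m.+2 + n).+1 Z)) -(ltr_pM2l f0) [X in X < _]e2 [X in _ < X]e1 eqC.
  by rewrite ltrD2l ltrN2.
(* The term [j = m + 2] gives strictness: there ['C(j, n + 2) = 0] and ['C(j, m + 2) = 1]. *)
have ltj : (m.+2 < m.+2 + n + 3)%N by lia.
rewrite /altsum (bigD1 (Ordinal ltj)) //= [X in _ < X](bigD1 (Ordinal ltj)) //=.
rewrite ltr_leD //.
  rewrite (@bin_small m.+2 n.+2) // muln0 mulr0n binn muln1.
  by rewrite pmulrn_lgt0 ?mixed_moment_gt0 // bin_gt0; lia.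
apply: ler_sum => i _; rewrite ler_wpMn2l ?mixed_moment_ge0 // leq_mul2l.
apply/orP; right; apply: leq_bin_mirror; have := ltn_ord i; lia.
Qed.

(** [flip] and [b_cdcd_lt_flip] alternate in the chain [(0, s) <= (s, 0) < (1, s-1) <= (s-1, 1) <
    ...], along which the minimum grows. *)
Lemma b_cdcd_order_of_flip s Z :
    (forall m n, (m < n)%N -> (m + n = s)%N -> b_cdcd m n Z <= b_cdcd n m Z) ->
  forall m1 n1 m2 n2, (m1 + n1 = s)%N -> (m2 + n2 = s)%N ->
    (minn m2 n2 < minn m1 n1)%N -> b_cdcd m2 n2 Z < b_cdcd m1 n1 Z.
Proof.
move=> flip m1 n1 m2 n2 s1 s2 lt_min.
have key d k : (2 * (k + d).+1 <= s)%N ->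
    b_cdcd (s - k) k Z < b_cdcd (k + d).+1 (s - (k + d).+1) Z.
  elim: d k => [|d IHd] k le_s.
    have -> : (s - k = (s - (k + 0).+1).+1)%N by lia.
    by rewrite {2}addn0; apply: b_cdcd_lt_flip; lia.
  apply: lt_le_trans (_ : b_cdcd k.+1 (s - k.+1) Z <= _).
    have -> : (s - k = (s - k.+1).+1)%N by lia.
    by apply: b_cdcd_lt_flip; lia.
  have := IHd k.+1; rewrite addSnnS => /(_ le_s)/ltW; apply: le_trans.
  by apply: flip; lia.
have le2 : b_cdcd m2 n2 Z <= b_cdcd (s - minn m2 n2) (minn m2 n2) Z.
  have [lt_mn | le_nm] := ltnP m2 n2.
    by rewrite -s2 addKn; apply: flip.
  by rewrite -s2 addnK.
have le1 : b_cdcd (minn m1 n1) (s - minn m1 n1) Z <= b_cdcd m1 n1 Z.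
  have [lt_mn | lt_nm | eq_mn] := ltngtP m1 n1.
  - by rewrite -s1 addKn.
  - by rewrite -s1 addnK; apply: flip => //; rewrite addnC.
  - by rewrite -s1 addKn.
apply: le_lt_trans le2 _; apply: lt_le_trans le1.
have := key (minn m1 n1 - (minn m2 n2).+1)%N (minn m2 n2).
have -> : (minn m2 n2 + (minn m1 n1 - (minn m2 n2).+1)).+1 = minn m1 n1 by lia.
by apply; lia.
Qed.

Lemma factr_b_cd_antitone m n Z : (m <= n)%N ->
  (n.+1)`!%:R * b_cd n Z <= (m.+1)`!%:R * b_cd m Z.
Proof.
move=> /subnK <-; elim: (n - m)%N => // k; apply: le_trans.
rewrite addSn [(_.+2)`!%:R]factrS [_ * _`!%:R]mulrC -mulrA ler_wpM2l //.
exact: b_cd_upper.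
Qed.

(** Induction on [m + n]. The [b Z] terms of the two recursions agree, and the left strip terms
    compare [(n-1, m)] with [(m-1, n)], which the order for total [m + n - 1] settles. *)
Lemma b_cdcd_flip m n Z : (m < n)%N -> b_cdcd m n Z <= b_cdcd n m Z.
Proof.
have [s] := ubnP (m + n); elim: s m n Z => // s IHs m n Z lt_s lt_mn.
rewrite -subr_ge0; move: Z.
apply: (@peel_ind _ (fun Z => (b_cdcd_pred n m Z - b_cdcd_pred m n Z)
    + (b_cd m Z / (n.+1)`!%:R - b_cd n Z / (m.+1)`!%:R))
  (fun Z => 2 * (cd_degree Z + m + n + 5)%:R)) => Z.
- by rewrite mulr_gt0 // ltr0n addnS.
- rewrite rpeelB; apply: (lin_comb2 1 (-1) (b_cdcd_rec n m Z) (b_cdcd_rec m n Z)).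
  have -> : b_cd m (nseq n false) = b_cd n (nseq m false).
    by rewrite [LHS]b_one_d [RHS]b_one_d [(n + m)%N]addnC [(n.+1)`!%:R * _]mulrC.
  by ring.
- rewrite addr_ge0 // subr_ge0; last first.
    have := factr_b_cd_antitone Z (ltnW lt_mn).
    have h k : 0 < (k.+1)`!%:R :> rat by rewrite ltr0n fact_gt0.
    by rewrite ler_pdivrMr // mulrAC ler_pdivlMr // mulrC [X in _ <= X]mulrC.
  case: n lt_s lt_mn => // n lt_s lt_mn; case: m lt_s lt_mn => [|m] lt_s lt_mn.
    exact/ltW/b_cdcd_gt0.
  apply/ltW/(@b_cdcd_order_of_flip (m + n.+1)); try lia.
  by move=> m' n' lt' e; apply: IHs => //; lia.
Qed.

Lemma b_cdcd_order m1 n1 m2 n2 Z : (m1 + n1 = m2 + n2)%N ->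
  (minn m2 n2 < minn m1 n1)%N -> b_cdcd m2 n2 Z < b_cdcd m1 n1 Z.
Proof.
move=> e; apply: (@b_cdcd_order_of_flip (m1 + n1)) => // m n lt_mn _.
exact: b_cdcd_flip.
Qed.

(** * Reversed words and pairs between two blocks *)

Lemma b_cd_rev m A : b (A ++ true :: nseq m false) = b_cd m (rev A).
Proof. by rewrite -b_rev rev_cat rev_cons cat_rcons rev_nseq. Qed.

Lemma b_cdcd_rev m n A :
  b (A ++ true :: nseq m false ++ true :: nseq n false) = b_cdcd n m (rev A).
Proof.
by rewrite -b_rev rev_cat rev_cons rev_cat rev_cons !cat_rcons !rev_nseq -catA.
Qed.

Lemma b_cd_order m1 n1 m2 n2 Y Z : (m1 + n1 = m2 + n2)%N ->
  (minn m2 n2 < minn m1 n1)%N -> b_cd m2 Y * b_cd n2 Z < b_cd m1 Y * b_cd n1 Z.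
Proof.
move=> e lt_min; have [lt_mn | le_nm] := ltnP m2 n2.
  have := @b_cd_balance m2 n1 (m1 - m2) Y Z; rewrite subnKC; last by lia.
  have -> : (n1 + (m1 - m2) = n2)%N by lia.
  by apply; lia.
have := @b_cd_balance n2 m1 (n1 - n2) Z Y; rewrite subnKC; last by lia.
have -> : (m1 + (n1 - n2) = m2)%N by lia.
by rewrite mulrC [X in _ < X]mulrC; apply; lia.
Qed.

Definition b_dcdcd m n A Z :=
  b (A ++ true :: nseq m false ++ true :: nseq n false ++ true :: Z).

Lemma b_dcdcd_rec m n A Z :
  2 * (cd_degree A + cd_degree Z + m + n + 7)%:R * b_dcdcd m n A Z =
    lpeel (fun y => b_dcdcd m n y Z) A + b A * b_cdcd m n Z + b_cd m (rev A) * b_cd n Z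
    + b_cdcd n m (rev A) * b Z + rpeel (b_dcdcd m n A) Z.
Proof.
have := b_join (A ++ true :: nseq m false ++ true :: nseq n false) Z.
rewrite !cd_degreeE -!catA /= -!catA /= -/(b_dcdcd m n A Z).
have -> : (cd_degree A + (2 + (m + (2 + n))) + cd_degree Z + 3 =
  cd_degree A + cd_degree Z + m + n + 7)%N by lia.
move=> ->; rewrite b_cdcd_rev; congr (_ + _ + _); last first.
  by apply: eq_rpeel => u _; rewrite -!catA /= -!catA.
rewrite /lpeel lstrip_join dsplit_cat /= dsplit_cat /= !dsplit_nseq !cats0 b_cd_rev.
rewrite add0r addr0 -!addrA; congr (_ + _).
  by apply: eq_lstrip => u _; rewrite -!catA /= -!catA.
congr (_ + _); last by rewrite -!catA /= -/(b_cdcd m n Z).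
by apply: eq_dsplit => // u _; rewrite -!catA /= -!catA.
Qed.

Lemma lpeelB f g Z : lpeel (fun x => f x - g x) Z = lpeel f Z - lpeel g Z.
Proof.
have := lpeelD f g (-1) Z; rewrite mulN1r => <-; congr (_ + _).
  by apply: eq_lstrip => u _; rewrite mulN1r.
by apply: eq_dsplit => // u _; rewrite mulN1r.
Qed.

(** Cuts inside [A] or [Z] give shorter instances; cuts at the three displayed [d] give products
    already ordered. *)
Lemma b_dcdcd_order m1 n1 m2 n2 A Z : (m1 + n1 = m2 + n2)%N ->
  (minn m2 n2 < minn m1 n1)%N -> b_dcdcd m2 n2 A Z < b_dcdcd m1 n1 A Z.
Proof.
move=> e lt_min; have [k] := ubnP (size A + size Z).
elim: k A Z => // k IHk A Z lt_k; rewrite -subr_gt0.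
suff: 0 < 2 * (cd_degree A + cd_degree Z + m1 + n1 + 7)%:R *
    (b_dcdcd m1 n1 A Z - b_dcdcd m2 n2 A Z).
  by rewrite pmulr_rgt0 // mulr_gt0 // ltr0n addnS.
rewrite mulrBr b_dcdcd_rec -(addnA _ m1) e addnA b_dcdcd_rec.
have l0 : 0 <= lpeel (fun y => b_dcdcd m1 n1 y Z - b_dcdcd m2 n2 y Z) A.
  by apply: lpeel_ge0 => u ltu; rewrite subr_ge0; apply/ltW/IHk; lia.
have r0 : 0 <= rpeel (fun x => b_dcdcd m1 n1 A x - b_dcdcd m2 n2 A x) Z.
  by apply: rpeel_ge0 => u ltu; rewrite subr_ge0; apply/ltW/IHk; lia.
rewrite lpeelB in l0; rewrite rpeelB in r0.
have h1 : b A * b_cdcd m2 n2 Z < b A * b_cdcd m1 n1 Z by rewrite ltr_pM2l ?b_gt0 // b_cdcd_order.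
have h2 := b_cd_order (rev A) Z e lt_min.
have h3 : b_cdcd n2 m2 (rev A) * b Z < b_cdcd n1 m1 (rev A) * b Z.
  rewrite ltr_pM2r ?b_gt0 //; apply: b_cdcd_order; first by lia.
  by rewrite minnC [X in (_ < X)%N]minnC.
lra.
Qed.

(** By [b_one_d] only [(m+1)! (n+1)!] matters, and it is larger for the less balanced pair. *)
Lemma one_d_order m1 n1 m2 n2 : (m1 + n1 = m2 + n2)%N ->
    (minn m2 n2 < minn m1 n1)%N ->
  b (nseq m2 false ++ true :: nseq n2 false) < b (nseq m1 false ++ true :: nseq n1 false).
Proof.
move=> e lt_min; rewrite !b_one_d e.
have c0 : 0 < (m2 + n2 + 3)%:R :> rat by rewrite ltr0n addnS.
rewrite ltr_pM2r ?invr_gt0 // ltrD2r -!natrM ltf_pV2 ?posrE ?ltr0n ?muln_gt0 ?fact_gt0 //.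
rewrite ltr_nat.
have bal k l t : (k < l)%N -> (0 < t)%N -> ((k + t)`! * l`! < k`! * (l + t)`!)%N.
  move=> lt_kl; have step u : ((k + u)`! * l`! <= k`! * (l + u)`!)%N ->
      ((k + u.+1)`! * l`! < k`! * (l + u.+1)`!)%N.
    rewrite !addnS !factS => le_u; rewrite -mulnA [X in (_ < X)%N]mulnCA.
    apply: leq_ltn_trans (leq_mul (leqnn (k + u).+1) le_u) _.
    by rewrite ltn_pmul2r ?muln_gt0 ?fact_gt0 // ltnS ltn_add2r.
  case: t => // t _; apply: (step _ _); elim: t => [|t IHt]; first by rewrite !addn0.
  exact/ltnW/step.
have [lt_mn | le_nm] := ltnP m2 n2.
  have := @bal m2.+1 n1.+1 (m1 - m2)%N.
  have -> : (m2.+1 + (m1 - m2) = m1.+1)%N by lia.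
  have -> : (n1.+1 + (m1 - m2) = n2.+1)%N by lia.
  by apply; lia.
have := @bal n2.+1 m1.+1 (n1 - n2)%N.
have -> : (n2.+1 + (n1 - n2) = n1.+1)%N by lia.
have -> : (m1.+1 + (n1 - n2) = m2.+1)%N by lia.
by rewrite [(n1.+1`! * _)%N]mulnC [(n2.+1`! * _)%N]mulnC; apply; lia.
Qed.

End NormalizedCoefficients.

(** * Exponential generating functions *)

Section ExponentialSeries.
Context {R : nzRingType}.
Implicit Types (f g h : nat -> R) (a b : R).

(* A sequence [f] stands for the series [\sum_n f n x^n / n!]. *)
Definition egfM f g n := \sum_(k < n.+1) (f k * g (n - k)%N) *+ 'C(n, k).
Definition egfD f g n := f n + g n.
Definition egf1 n : R := (n == 0%N)%:R.
Definition egfl a f n := a * f n.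
Definition egfr f a n := f n * a.
Definition egf' f n := f n.+1.

Local Notation "f \* g" := (egfM f g) (at level 40, left associativity).
Local Notation "f \+ g" := (egfD f g).

Lemma egf_eq f g : (forall n, f n = g n) -> f = g.
Proof. exact: functional_extensionality. Qed.

Lemma egfMDl f g h : (f \+ g) \* h = (f \* h) \+ (g \* h).
Proof.
apply: egf_eq => n; rewrite /egfM /egfD -big_split.
by apply: eq_bigr => k _; rewrite mulrDl mulrnDl.
Qed.

Lemma egfMDr f g h : f \* (g \+ h) = (f \* g) \+ (f \* h).
Proof.
apply: egf_eq => n; rewrite /egfM /egfD -big_split.
by apply: eq_bigr => k _; rewrite mulrDr mulrnDl.
Qed.

Lemma egfM1 f : f \* egf1 = f.
Proof.
apply: egf_eq => n; rewrite /egfM /egf1 big_ord_recr /= subnn eqxx mulr1 binn.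
by rewrite big1 ?add0r // => i _; rewrite subn_eq0 leqNgt ltn_ord mulr0 mul0rn.
Qed.

Lemma egf1M f : egf1 \* f = f.
Proof.
apply: egf_eq => n; rewrite /egfM /egf1 big_ord_recl /= subn0 mul1r bin0.
by rewrite big1 ?addr0 // => i _; rewrite mul0r mul0rn.
Qed.

Lemma egfMr f a g : egfr f a \* g = f \* egfl a g.
Proof.
by apply: egf_eq => n; apply: eq_bigr => k _; rewrite /egfr /egfl mulrA.
Qed.

Lemma egfMl f a g : egfl a f \* g = egfl a (f \* g).
Proof.
apply: egf_eq => n; rewrite /egfl mulr_sumr; apply: eq_bigr => k _.
by rewrite mulrnAr mulrA.
Qed.

Lemma egfrM f g a : egfr (f \* g) a = f \* egfr g a.
Proof.
apply: egf_eq => n; rewrite /egfr mulr_suml; apply: eq_bigr => k _.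
by rewrite mulrnAl mulrA.
Qed.

Lemma egf'M f g : egf' (f \* g) = (egf' f \* g) \+ (f \* egf' g).
Proof.
apply: egf_eq => n; rewrite /egf' /egfM /egfD.
rewrite (pascal_sum (fun k => f k * g (n.+1 - k)%N)) addrC -big_split.
apply: eq_bigr => k _ /=; rewrite -mulrnDl subSS -subSn //.
by rewrite -ltnS.
Qed.

Lemma egfM0 f g : (f \* g) 0%N = f 0%N * g 0%N.
Proof. by rewrite /egfM big_ord1 bin0. Qed.

(** The product rule reduces a coefficient to the preceding one for the derivatives. *)
Lemma egfMA f g h : f \* (g \* h) = (f \* g) \* h.
Proof.
apply: egf_eq => n; elim: n f g h => [|n IHn] f g h; first by rewrite !egfM0 mulrA.
rewrite -[LHS]/(egf' _ n) -[RHS]/(egf' _ n) !egf'M egfMDl egfMDr /egfD.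
by rewrite !IHn addrA.
Qed.

Lemma egf_fix0 e f : e 0%N = 0 -> f = e \* f -> forall n, f n = 0.
Proof.
move=> e0 eqf n; have [m] := ubnP n; elim: m n => // m IHm n lt_n.
rewrite eqf /egfM big_ord_recl e0 mul0r mul0rn add0r big1 // => i _.
rewrite IHm ?mulr0 ?mul0rn // lift0.
have := ltn_ord i; case: n lt_n i => [|n] lt_n i; first by case: i.
by rewrite subSS => _; apply: leq_ltn_trans (leq_subr _ _) _.
Qed.

End ExponentialSeries.

(** * The Riccati equation of the ab-series *)

Section RiccatiEquation.
Context {R : nzRingType} (a b : R) (X : nat -> R).

Local Notation "f \* g" := (egfM f g) (at level 40, left associativity).
Local Notation "f \+ g" := (egfD f g).

(** The series [(exp (q x) - 1) / q], which solves [e' = 1 + q e] with zero constant term. *)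
Definition egf_geom (q : R) n := if n is n'.+1 then q ^+ n' else 0.

Local Notation e := (egf_geom (a - b)).

Hypothesis X_fix : X = e \+ (egfr e b \* X).

Lemma egf_geom'l q : egf' (egf_geom q) = egf1 \+ egfl q (egf_geom q).
Proof.
apply: egf_eq => -[|n]; rewrite /egf' /egfD /egfl /egf1 /=; first by rewrite mulr0 addr0.
by rewrite add0r exprS.
Qed.

Lemma egf_geom'r q : egf' (egf_geom q) = egf1 \+ egfr (egf_geom q) q.
Proof.
apply: egf_eq => -[|n]; rewrite /egf' /egfD /egfr /egf1 /=; first by rewrite mul0r addr0.
by rewrite add0r exprSr.
Qed.

Lemma X_zero : X 0%N = 0.
Proof. by rewrite X_fix /egfD egfM0 /egfr /= mul0r mul0r addr0. Qed.

Lemma X'_fix : egf' X = (egf' e \* (egf1 \+ egfl b X)) \+ (egfr e b \* egf' X).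
Proof.
rewrite {1}X_fix.
have -> : egf' (e \+ (egfr e b \* X)) = egf' e \+ egf' (egfr e b \* X) by [].
rewrite egf'M egfMDr egfM1.
have -> : egf' (egfr e b) = egfr (egf' e) b by [].
by rewrite egfMr; apply: egf_eq => n; rewrite /egfD addrA.
Qed.

(** The coefficient [e b] has no constant term, so the linear equation for [X'] has one solution and
    candidates need only be checked in it. *)
Lemma X'_unique Q :
  Q = (egf' e \* (egf1 \+ egfl b X)) \+ (egfr e b \* Q) -> egf' X = Q.
Proof.
move=> Q_fix; pose f := egf' X \+ egfr Q (-1).
have f_fix : f = egfr e b \* f.
  rewrite /f egfMDr -egfrM {1}X'_fix {1}Q_fix.
  by apply: egf_eq => n; rewrite /egfD /egfr !mulrN1 opprD addrACA subrr add0r.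
apply: egf_eq => n; apply/eqP; rewrite -subr_eq0; apply/eqP.
have := egf_fix0 _ f_fix n; rewrite /f /egfD /egfr mulrN1; apply.
by rewrite mul0r.
Qed.

Lemma X'_eq1 : egf' X = (egf1 \+ egfr X a) \* (egf1 \+ egfl b X).
Proof.
apply: X'_unique; rewrite egfMA -egfMDl; congr (_ \* _).
rewrite egf_geom'r egfMDr egfM1 -egfrM {1}X_fix.
apply: egf_eq => n; rewrite /egfD /egfr mulrBr mulrDl.
by rewrite -!addrA; congr (_ + (_ + _)); rewrite addKr.
Qed.

Lemma X'_eq2 : egf' X = (egf1 \+ egfr X b) \* (egf1 \+ egfl a X).
Proof.
have eE : egf' e \* (egf1 \+ egfl b X) = egf1 \+ egfl a X.
  rewrite egf_geom'l egfMDl egf1M egfMl egfMDr egfM1 -egfMr -X_fix.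
  apply: egf_eq => n; rewrite /egfD /egfl mulrBl.
  by rewrite -!addrA; congr (_ + _); rewrite addrC subrK.
apply: X'_unique; rewrite eE egfMA -[X in _ = X \+ _]egf1M -egfMDl; congr (_ \* _).
rewrite egfMDr egfM1 -egfrM {1}X_fix.
by apply: egf_eq => n; rewrite /egfD /egfr mulrDl.
Qed.

Lemma X'_sum n :
  X n.+1 *+ 2 = (n == 0%N)%:R *+ 2 + (a + b) * X n + X n * (a + b)
    + \sum_(k < n.+1) (X k * (a * b + b * a) * X (n - k)%N) *+ 'C(n, k).
Proof.
rewrite mulr2n -{1}[X n.+1]/(egf' X n) -[X n.+1]/(egf' X n) {1}X'_eq1 X'_eq2.
rewrite !egfMDl !egfMDr !egf1M !egfM1 /egfD.
have -> : \sum_(k < n.+1) X k * (a * b + b * a) * X (n - k)%N *+ 'C(n, k) =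
    ((egfr X a \* egfl b X) \+ (egfr X b \* egfl a X)) n.
  rewrite /egfD /egfM -big_split; apply: eq_bigr => k _ /=.
  by rewrite -mulrnDl /egfr /egfl !mulrDr !mulrDl !mulrA.
rewrite /egfD /egf1 mulr2n.
have lE c : egfl c X n = c * X n by [].
have rE c : egfr X c n = X n * c by [].
rewrite !lE !rE mulrDl mulrDr.
move: (egfM _ _ n) (egfM _ _ n) (_%:R) (a * _) (b * _) (_ * a) (_ * b).
move=> y1 y2 z xa xb ax bx.
rewrite addrACA [ax + y2 + _]addrACA [z + xb + _]addrACA [xb + xa]addrC.
by rewrite !addrA.
Qed.

Lemma X''_eq n :
  X n.+2 = (a + b) * X n.+1
    + \sum_(k < n.+1) (X k * (a * b + b * a) * X (n - k).+1) *+ 'C(n, k).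
Proof.
(* Differentiating [X'_eq2] gives [X' b (1 + a X) + (1 + X b) a X']. By [X'_eq1] and
   [(1 + b X) b = b (1 + X b)] the first summand becomes [(1 + X a) b X']. *)
have e2 : egf' (egf' X) =
    ((egf1 \+ egfr X a) \* egfl b (egf' X)) \+ ((egf1 \+ egfr X b) \* egfl a (egf' X)).
  rewrite {1}X'_eq2 egf'M; congr (_ \+ _).
    have -> : egf' (egf1 \+ egfr X b) = egfr (egf' X) b.
      by apply: egf_eq => k; rewrite /egf' /egfD /egf1 /= add0r.
    rewrite {1}X'_eq1 egfrM -egfMA; congr (_ \* _).
    rewrite X'_eq2 -egfMl; congr (_ \* _).
    by apply: egf_eq => -[|k]; rewrite /egfr /egfl /egfD /egf1 /= mulrDl mulrDr ?mulr1 ?mul1r ?mulr0 ?mul0r mulrA.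
  congr (_ \* _).
  by apply: egf_eq => k; rewrite /egf' /egfD /egf1 /= add0r.
rewrite -[LHS]/(egf' (egf' X) n) e2 !egfMDl !egf1M /egfD.
have -> : \sum_(k < n.+1) X k * (a * b + b * a) * X (n - k).+1 *+ 'C(n, k) =
    ((egfr X a \* egfl b (egf' X)) \+ (egfr X b \* egfl a (egf' X))) n.
  rewrite /egfD /egfM -big_split; apply: eq_bigr => k _ /=.
  by rewrite -mulrnDl /egfr /egfl !mulrDr !mulrDl !mulrA.
by rewrite /egfl addrACA [b * _ + _]addrC mulrDl.
Qed.

End RiccatiEquation.

(** * cd-polynomials in a free ring *)

Lemma dsplit_sum (R : numDomainType) I (r : seq I) (F G : I -> seq bool -> R) f g v :
    (forall x y, x ++ true :: y = v -> \sum_(k <- r) F k x * G k y = f x * g y) ->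
  \sum_(k <- r) dsplit (F k) (G k) v = dsplit f g v.
Proof.
elim: v F f => [|x v IHv] F f FG /=; first by rewrite big1.
rewrite big_split /=; congr (_ + _).
  by case: x FG => FG; [apply: (FG [::]) | rewrite big1].
by apply: IHv => y z eqv; apply: (FG (x :: y)); rewrite /= eqv.
Qed.

Lemma rmorph_dsplit (R S : numDomainType) (phi : {rmorphism R -> S}) f g v :
  phi (dsplit f g v) = dsplit (fun x => phi (f x)) (fun x => phi (g x)) v.
Proof.
elim: v f => [|x v IHv] f /=; first by rewrite rmorph0.
by rewrite rmorphD IHv; case: x; rewrite ?rmorphM ?rmorph0.
Qed.

Lemma rmorph_lstrip (R S : numDomainType) (phi : {rmorphism R -> S}) f v :
  phi (lstrip f v) = lstrip (fun x => phi (f x)) v.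
Proof. by case: v => [|[] v] //=; rewrite rmorph0. Qed.

Lemma rmorph_rstrip (R S : numDomainType) (phi : {rmorphism R -> S}) f v :
  phi (rstrip f v) = rstrip (fun x => phi (f x)) v.
Proof. exact: rmorph_lstrip. Qed.

Lemma eq_lstrip_degree (R : numDomainType) (f f' : seq bool -> R) v :
  (forall u, cd_degree v = (cd_degree u).+1 -> f u = f' u) -> lstrip f v = lstrip f' v.
Proof. by case: v => [|[] v] //= eqf; apply: eqf; rewrite cd_degree_cons. Qed.

Lemma eq_rstrip_degree (R : numDomainType) (f f' : seq bool -> R) v :
  (forall u, cd_degree v = (cd_degree u).+1 -> f u = f' u) -> rstrip f v = rstrip f' v.
Proof.
move=> eqf; apply: eq_lstrip_degree => u; rewrite cd_degree_rev => e.
by apply: eqf; rewrite cd_degree_rev.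
Qed.

Lemma mul_lstrip (R : numDomainType) a (f : seq bool -> R) v :
  a * lstrip f v = lstrip (fun x => a * f x) v.
Proof. by case: v => [|[] v] /=; rewrite ?mulr0. Qed.

Lemma mul_rstrip (R : numDomainType) a (f : seq bool -> R) v :
  a * rstrip f v = rstrip (fun x => a * f x) v.
Proof. exact: mul_lstrip. Qed.

Lemma mul_dsplit (R : numDomainType) a (f g : seq bool -> R) v :
  a * dsplit f g v = dsplit (fun x => a * f x) g v.
Proof.
elim: v f => [|x v IHv] f /=; first by rewrite mulr0.
by rewrite mulrDr IHv; case: x; rewrite ?mulr0 ?mulrA.
Qed.

Section FreeRing.
(** An interface for the free ring on two letters, instantiated later by [ncpoly]: [mon] embeds
    words, [coefw] reads coefficients, [ext h] extends [h] additively. *)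
Variables (A : nzRingType) (mon : seq bool -> A) (coefw : A -> seq bool -> int).
Variable ext : (seq bool -> A) -> A -> A.
Hypothesis monM : forall u v, mon u * mon v = mon (u ++ v).
Hypothesis mon_nil : mon [::] = 1.
Hypothesis mon_ind : forall P : A -> Prop,
  P 0 -> (forall F G, P F -> P G -> P (F + G)) -> (forall F, P F -> P (- F)) ->
  (forall w, P (mon w)) -> forall F, P F.
Hypothesis extB : forall h, {morph ext h : F G / F - G}.
Hypothesis ext_mon : forall h w, ext h (mon w) = h w.
Hypothesis coefwB : forall w, {morph coefw^~ w : F G / F - G}.
Hypothesis coefw_mon : forall u w, coefw (mon u) w = (u == w)%:R.
Hypothesis coefw_eq : forall F G, coefw F =1 coefw G -> F = G.

Definition var x := mon [:: x].

Lemma mon_cons x w : mon (x :: w) = var x * mon w.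
Proof. by rewrite monM. Qed.

Lemma ext0 h : ext h 0 = 0.
Proof. by have := extB h 0 0; rewrite !subrr. Qed.

Lemma extN h F : ext h (- F) = - ext h F.
Proof. by rewrite -[- F]sub0r extB ext0 sub0r. Qed.

Lemma extD h : {morph ext h : F G / F + G}.
Proof. by move=> F G; rewrite -{1}[G]opprK extB extN opprK. Qed.

Lemma coefw0 w : coefw 0 w = 0.
Proof. by have := coefwB w 0 0; rewrite !subrr. Qed.

Lemma coefwN F w : coefw (- F) w = - coefw F w.
Proof. by rewrite -[- F]sub0r coefwB coefw0 sub0r. Qed.

Lemma coefwD F G w : coefw (F + G) w = coefw F w + coefw G w.
Proof. by rewrite -{1}[G]opprK coefwB coefwN opprK. Qed.

Lemma coefwMn F n w : coefw (F *+ n) w = coefw F w *+ n.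
Proof. by elim: n => [|n IHn]; rewrite ?coefw0 // !mulrS coefwD IHn. Qed.

Lemma coefw_sum I (r : seq I) (P : pred I) (F : I -> A) w :
  coefw (\sum_(i <- r | P i) F i) w = \sum_(i <- r | P i) coefw (F i) w.
Proof. by apply: (big_morph (coefw^~ w)) => [F' G'|]; rewrite ?coefwD ?coefw0. Qed.

Lemma coefw1 w : coefw 1 w = (w == [::])%:R.
Proof. by rewrite -mon_nil coefw_mon eq_sym. Qed.

Lemma coefw_intM (z : int) F w : coefw (z%:~R * F) w = z * coefw F w.
Proof.
rewrite mulrzl; case: z => n; first by rewrite -[F *~ n]/(F *+ n) coefwMn -(natz n) mulr_natl.
by rewrite NegzE mulrNz coefwN -[F *~ _]/(F *+ n.+1) coefwMn mulNr -(natz n.+1) mulr_natl.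
Qed.

Definition cd_letter (x : bool) : A :=
  if x then var false * var true + var true * var false else var false + var true.

Definition cdev := ext (fun w => \prod_(x <- w) cd_letter x).

Lemma cdevB : {morph cdev : F G / F - G}.
Proof. exact: extB. Qed.

Lemma cdevD : {morph cdev : F G / F + G}.
Proof. exact: extD. Qed.

Lemma cdevN : {morph cdev : F / - F}.
Proof. exact: extN. Qed.

Lemma cdev0 : cdev 0 = 0.
Proof. exact: ext0. Qed.

Lemma cdev_mon w : cdev (mon w) = \prod_(x <- w) cd_letter x.
Proof. exact: ext_mon. Qed.

Lemma cdev1 : cdev 1 = 1.
Proof. by rewrite -{1}mon_nil cdev_mon big_nil. Qed.

Lemma cdev_var x : cdev (var x) = cd_letter x.
Proof. by rewrite (cdev_mon [:: x]) big_seq1. Qed.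

Lemma cdevM : {morph cdev : F G / F * G}.
Proof.
move=> F G; elim/mon_ind: F G => [|F F' IH IH'|F IH|u] G.
- by rewrite mul0r cdev0 mul0r.
- by rewrite mulrDl !cdevD IH IH' mulrDl.
- by rewrite mulNr !cdevN IH mulNr.
elim/mon_ind: G => [|G G' IH IH'|G IH|v].
- by rewrite mulr0 cdev0 mulr0.
- by rewrite mulrDr !cdevD IH IH' mulrDr.
- by rewrite mulrN !cdevN IH mulrN.
- by rewrite monM !cdev_mon big_cat.
Qed.

Lemma cdevMn F n : cdev (F *+ n) = cdev F *+ n.
Proof. by elim: n => [|n IHn]; rewrite ?cdev0 // !mulrS cdevD IHn. Qed.

Lemma cdev_sum I (r : seq I) (P : pred I) (F : I -> A) :
  cdev (\sum_(i <- r | P i) F i) = \sum_(i <- r | P i) cdev (F i).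
Proof. exact: (big_morph _ cdevD cdev0). Qed.

(** * Left quotients and injectivity of the cd-substitution *)

Definition lquo (x : bool) : A -> A :=
  ext (fun w => if w is y :: w' then if x == y then mon w' else 0 else 0).

Lemma lquoD x F G : lquo x (F + G) = lquo x F + lquo x G.
Proof. exact: extD. Qed.

Lemma lquoN x F : lquo x (- F) = - lquo x F.
Proof. exact: extN. Qed.

Lemma lquo0 x : lquo x 0 = 0.
Proof. exact: ext0. Qed.

Lemma lquoMn x F n : lquo x (F *+ n) = lquo x F *+ n.
Proof. by elim: n => [|n IHn]; rewrite ?lquo0 // !mulrS lquoD IHn. Qed.

Lemma lquo_cons x y w : lquo x (mon (y :: w)) = if x == y then mon w else 0.
Proof. exact: ext_mon. Qed.

Lemma lquo1 x : lquo x 1 = 0.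
Proof. by rewrite -mon_nil; apply: ext_mon. Qed.

Lemma coefw_lquo x F w : coefw (lquo x F) w = coefw F (x :: w).
Proof.
elim/mon_ind: F => [|F G IH IH'|F IH|u].
- by rewrite /lquo ext0 !coefw0.
- by rewrite /lquo extD !coefwD -IH -IH'.
- by rewrite /lquo extN !coefwN -IH.
case: u => [|y u]; first by rewrite mon_nil lquo1 coefw0 coefw1.
rewrite lquo_cons coefw_mon eqseq_cons (eq_sym y).
by case: (x == y); rewrite ?coefw_mon ?coefw0.
Qed.

Lemma lquo_varM x y G : lquo x (var y * G) = if x == y then G else 0.
Proof.
elim/mon_ind: G => [|F G IH IH'|F IH|u].
- by rewrite mulr0 /lquo ext0 if_same.
- rewrite mulrDr /lquo extD -!/(lquo x _) IH IH'.
  by case: (x == y); rewrite ?addr0.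
- by rewrite mulrN /lquo extN -!/(lquo x _) IH; case: (x == y); rewrite ?oppr0.
- by rewrite -mon_cons lquo_cons.
Qed.

Lemma left_decomposition F :
  F = (coefw F [::])%:~R + var false * lquo false F + var true * lquo true F.
Proof.
elim/mon_ind: F => [|F G IH IH'|F IH|u].
- by rewrite coefw0 /lquo !ext0 !mulr0 !addr0.
- rewrite {1}IH {1}IH' coefwD rmorphD /lquo !extD !mulrDr -!/(lquo _ _).
  by rewrite addrACA; congr (_ + _); rewrite addrACA.
- by rewrite {1}IH coefwN rmorphN /lquo !extN !mulrN !opprD.
case: u => [|y u]; first by rewrite mon_nil coefw1 !lquo1 !mulr0 !addr0.
rewrite coefw_mon !lquo_cons add0r mon_cons.
by case: y => /=; rewrite mulr0 ?add0r ?addr0.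
Qed.

Lemma lquoM x F G : lquo x (F * G) = lquo x F * G + (coefw F [::])%:~R * lquo x G.
Proof.
rewrite {1}(left_decomposition F) !mulrDl -!mulrA /lquo !extD -!/(lquo _ _) !lquo_varM.
have -> : lquo x ((coefw F [::])%:~R * G) = (coefw F [::])%:~R * lquo x G.
  rewrite !mulrzl; case: (coefw F [::]) => n; first exact: lquoMn.
  by rewrite NegzE !mulrNz lquoN; congr (- _); apply: lquoMn.
by rewrite addrC addrA addrC addrA; case: x => /=; rewrite ?add0r ?addr0 addrC.
Qed.

Lemma coefwM_nil F G : coefw (F * G) [::] = coefw F [::] * coefw G [::].
Proof.
elim/mon_ind: F => [|F F' IH IH'|F IH|u].
- by rewrite mul0r !coefw0 mul0r.
- by rewrite mulrDl !coefwD IH IH' mulrDl.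
- by rewrite mulNr !coefwN IH mulNr.
elim/mon_ind: G => [|F F' IH IH'|F IH|v].
- by rewrite mulr0 !coefw0 mulr0.
- by rewrite mulrDr !coefwD IH IH' mulrDr.
- by rewrite mulrN !coefwN IH mulrN.
by rewrite monM !coefw_mon; case: u v => [|x u] [|y v].
Qed.

Lemma coefw_var_nil x : coefw (var x) [::] = 0.
Proof. by rewrite (coefw_mon [:: x]). Qed.

Lemma cdev_int (z : int) : cdev z%:~R = z%:~R.
Proof.
case: z => n; first by rewrite -[_%:~R]/(1 *+ n) cdevMn cdev1.
rewrite NegzE !mulrNz cdevN; congr (- _).
by rewrite -[_%:~R]/(1 *+ n.+1) cdevMn cdev1.
Qed.

Lemma lquo_int x (z : int) : lquo x z%:~R = 0.
Proof.
have h n : lquo x (1 *+ n) = 0.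
  by elim: n => [|n IHn]; rewrite ?mulrS ?lquoD ?lquo1 ?IHn ?addr0 // /lquo ext0.
case: z => n; first exact: h.
by rewrite NegzE mulrNz /lquo extN -/(lquo _ _) [lquo _ _]h oppr0.
Qed.

(** The image is [z + (a + b) H1 + (ab + ba) H2], with [H1], [H2] the images of the quotients of
    [H]. Its quotients by [a] and [b] give [H1 + b H2 = 0 = H1 + a H2], so [b H2 = a H2] and
    [H2 = 0]. *)
Lemma cdev_eq0 H : cdev H = 0 ->
  coefw H [::] = 0 /\ forall x, cdev (lquo x H) = 0.
Proof.
move=> H0; move: H0; rewrite {1}(left_decomposition H).
rewrite !cdevD !cdevM !cdev_var cdev_int /= !mulrDl -!mulrA.
set z := (coefw H [::]); set H1 := cdev (lquo false H).
set H2 := cdev (lquo true H) => e.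
have ea : H1 + var true * H2 = 0.
  have := congr1 (lquo false) e; rewrite !lquoD lquo_int !lquo_varM /=.
  by rewrite add0r !addr0 /lquo ext0.
have eb : H1 + var false * H2 = 0.
  have := congr1 (lquo true) e; rewrite !lquoD lquo_int !lquo_varM /=.
  by rewrite !add0r /lquo ext0.
have h2 : H2 = 0.
  have : var true * H2 = var false * H2 by apply: (addrI H1); rewrite ea eb.
  by move/(congr1 (lquo true)); rewrite !lquo_varM.
have h1 : H1 = 0 by move: ea; rewrite h2 mulr0 addr0.
split; last by case.
move: e; rewrite h1 h2 !mulr0 !addr0 => /(congr1 (coefw^~ [::])); rewrite coefw0.
have h n : coefw (1 *+ n) [::] = n%:Z by rewrite coefwMn coefw1 eqxx; apply: natz.
case: {h1 h2 ea eb} z => n; first by rewrite [LHS]h.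
by rewrite NegzE mulrNz coefwN [coefw _ _]h.
Qed.

Lemma cdev_inj : injective cdev.
Proof.
move=> F G /eqP; rewrite -subr_eq0 -cdevB => /eqP H0.
apply/eqP; rewrite -subr_eq0; apply/eqP; apply: coefw_eq => w; rewrite coefw0.
elim: w (F - G) H0 => [|x w IHw] H /cdev_eq0 [// c0 q0].
by rewrite -coefw_lquo; apply: IHw.
Qed.

Lemma coefw_cM x F w : coefw (var x * F) w = if w is y :: w' then if x == y then coefw F w' else 0 else 0.
Proof.
case: w => [|y w]; first by rewrite coefwM_nil coefw_var_nil mul0r.
by rewrite -coefw_lquo lquo_varM eq_sym; case: (x == y); rewrite ?coefw0.
Qed.

Lemma coefwM_cons F G x w :
  coefw (F * G) (x :: w) = coefw (lquo x F * G) w + coefw F [::] * coefw G (x :: w).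
Proof.
by rewrite -coefw_lquo lquoM coefwD coefw_intM coefw_lquo.
Qed.

Lemma coefw_dsplit F G v : coefw (F * var true * G) v = dsplit (coefw F) (coefw G) v.
Proof.
rewrite -mulrA; elim: v F => [|x v IHv] F.
  by rewrite coefwM_nil coefw_cM mulr0.
rewrite coefwM_cons IHv coefw_cM /= addrC eq_sym; congr (_ + _).
  by case: x; rewrite ?mulr0.
by apply: eq_dsplit => // u _; rewrite coefw_lquo.
Qed.

Lemma coefw_lstrip F v : coefw (var false * F) v = lstrip (coefw F) v.
Proof. by rewrite coefw_cM; case: v => [|[] v]. Qed.

Lemma coefw_rstrip F v : coefw (F * var false) v = rstrip (coefw F) v.
Proof.
elim: v F => [|x v IHv] F; first by rewrite coefwM_nil coefw_var_nil mulr0.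
rewrite coefwM_cons IHv coefw_mon eqseq_cons.
case: v {IHv} => [|y v]; first by case: x; rewrite /= ?mulr0 ?mulr1 add0r.
rewrite andbF mulr0 addr0 /rstrip [rev [:: x, y & v]]rev_cons.
case E: (rev (y :: v)) => [|z t].
  by have := congr1 size E; rewrite size_rev.
by case: z {E} => //=; rewrite coefw_lquo rev_rcons.
Qed.

(** * Coefficients of the cd-series *)

Variable X : nat -> A.
Hypothesis X_fix :
  X = egfD (egf_geom (var false - var true))
        (egfM (egfr (egf_geom (var false - var true)) (var true)) X).

Lemma cdev_exists n : exists F, cdev F = X n.
Proof.
have [m] := ubnP n; elim: m n => // m IHm n lt_n.
(* Chosen preimages at smaller indices, fed into the formula for [X'']. *)
pose Phi k := epsilon (inhabits (0 : A)) (fun F => cdev F = X k).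
have PhiE k : (k < m)%N -> cdev (Phi k) = X k by move=> /IHm; apply: epsilon_spec.
case: n lt_n => [|[|n]] lt_n.
- by exists 0; rewrite cdev0 (X_zero X_fix).
- exists 1; rewrite cdev1 -[X 1%N]/(egf' X 0%N) (X'_eq1 X_fix) egfM0.
  by rewrite /egfD /egfr /egfl /egf1 (X_zero X_fix) mul0r mulr0 addr0 mulr1.
exists (var false * Phi n.+1
  + \sum_(k < n.+1) (Phi k * var true * Phi (n - k).+1) *+ 'C(n, k)).
rewrite (X''_eq X_fix) cdevD cdevM cdev_var PhiE //; congr (_ + _).
rewrite cdev_sum; apply: eq_bigr => k _; rewrite cdevMn !cdevM cdev_var !PhiE //.
all: by have := ltn_ord k; lia.
Qed.

Variable Phi : nat -> A.
Hypothesis PhiE : forall n, cdev (Phi n) = X n.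

Lemma Phi_sum n :
  Phi n.+1 *+ 2 = (n == 0%N)%:R *+ 2 + var false * Phi n + Phi n * var false
    + \sum_(k < n.+1) (Phi k * var true * Phi (n - k)%N) *+ 'C(n, k).
Proof.
apply: cdev_inj; rewrite cdevMn PhiE (X'_sum X_fix) 3!cdevD 2!cdevM cdevMn cdev_var !PhiE.
congr (_ *+ 2 + _ + _ + _); first by case: n => [|n]; rewrite ?cdev1 ?cdev0.
rewrite cdev_sum; apply: eq_bigr => k _.
by rewrite cdevMn !cdevM cdev_var !PhiE.
Qed.

Lemma coefw_Phi_sum n v :
  coefw (Phi n.+1) v *+ 2 = ((n == 0%N) && (v == [::]))%:R *+ 2
    + lstrip (coefw (Phi n)) v + rstrip (coefw (Phi n)) v
    + \sum_(k < n.+1) dsplit (coefw (Phi k)) (coefw (Phi (n - k)%N)) v *+ 'C(n, k).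
Proof.
rewrite -coefwMn Phi_sum !coefwD coefw_lstrip coefw_rstrip coefw_sum.
congr (_ + _ + _ + _).
  by rewrite coefwMn; case: n => [|n]; rewrite ?coefw1 ?coefw0.
by apply: eq_bigr => k _; rewrite coefwMn coefw_dsplit.
Qed.

(** If the degree does not match, every term of the coefficient recursion has a factor whose degree
    does not match either. *)
Lemma coefw_Phi_homog n v : (cd_degree v).+1 != n -> coefw (Phi n) v = 0.
Proof.
have [m] := ubnP n; elim: m n v => // m IHm [|n] v lt_n neq_n.
  have -> : Phi 0 = 0 by apply: cdev_inj; rewrite cdev0 PhiE (X_zero X_fix).
  exact: coefw0.
apply/eqP; rewrite -[_ == 0]/(false || (coefw _ _ == 0)) -(mulrn_eq0 _ 2) coefw_Phi_sum.
have z0 : ((n == 0%N) && (v == [::])) = false.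
  apply/negP => /andP[/eqP n0 /eqP v0]; move: neq_n.
  by rewrite n0 v0 cd_degree_nil.
have homog u : cd_degree v = (cd_degree u).+1 -> coefw (Phi n) u = 0.
  by move=> e; apply: IHm; [exact: lt_n | rewrite -e -eqSS].
rewrite z0 (eq_lstrip_degree (f' := fun _ => 0) homog) (eq_rstrip_degree (f' := fun _ => 0) homog).
have st0 u : lstrip (fun _ => 0) u = 0 :> int by case: u => [|[]].
rewrite /rstrip !st0 !add0r big1 // => k _.
suff -> : dsplit (coefw (Phi k)) (coefw (Phi (n - k)%N)) v = 0 by rewrite mul0rn.
(* An empty sum in [dsplit_sum] leaves only the vanishing of each product to prove. *)
apply: etrans (esym (@dsplit_sum _ void [::] (fun _ _ => 0) (fun _ _ => 0) _ _ v _)) _;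
  last by rewrite big_nil.
move=> x y e.
rewrite big_nil; have [ex | nx] := eqVneq (cd_degree x).+1 k; last first.
  by rewrite (IHm k) ?mul0r //; have := ltn_ord k; lia.
rewrite mulrC (IHm (n - k)%N) ?mul0r //; first by lia.
apply: contra neq_n => /eqP ey; rewrite -e !cd_degreeE.
have := ltn_ord k; rewrite -ex in ey *; lia.
Qed.

Definition ncoef v : rat :=
  (coefw (Phi (cd_degree v).+1) v)%:~R / ((cd_degree v).+1)`!%:R.

(** After multiplication by [n!], homogeneity leaves one [k] per factorization, and ['C(n, k)]
    distributes the factorials. *)
Lemma ncoef_rec v :
  2 * (cd_degree v).+1%:R * ncoef v =
    (if v is [::] then 2 else 0) + lstrip ncoef v + rstrip ncoef v + dsplit ncoef ncoef v.
Proof.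
set n := cd_degree v; have f0 : n`!%:R != 0 :> rat by rewrite pnatr_eq0 -lt0n fact_gt0.
have n0 : n.+1%:R != 0 :> rat by rewrite pnatr_eq0.
apply: (mulfI f0).
have -> : n`!%:R * (2 * n.+1%:R * ncoef v) = (coefw (Phi n.+1) v *+ 2)%:~R.
  rewrite /ncoef -/n factS natrM rmorphMn /= -mulr_natr.
  by move: (n.+1%:R) n0 => N N0; field; rewrite f0 N0.
have scale u : n = (cd_degree u).+1 -> (coefw (Phi n) u)%:~R = n`!%:R * ncoef u.
  by move=> e; rewrite /ncoef -e mulrCA divff // mulr1.
rewrite coefw_Phi_sum !rmorphD /= !mulrDr; congr (_ + _ + _ + _).
- clear scale; rewrite {}/n in f0 n0 *; case: v f0 n0 => [|x v] f0 n0.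
    by rewrite cd_degree_nil mul1r.
  by rewrite andbF mulr0.
- by rewrite rmorph_lstrip mul_lstrip; apply: eq_lstrip_degree => u /scale.
- by rewrite rmorph_rstrip mul_rstrip; apply: eq_rstrip_degree => u /scale.
rewrite rmorph_sum mul_dsplit /=.
rewrite -(@dsplit_sum _ _ (index_enum 'I_n.+1)
  (fun k x => 'C(n, k)%:R * (coefw (Phi k) x)%:~R) (fun k y => (coefw (Phi (n - k)%N) y)%:~R)).
  apply: eq_bigr => k _; rewrite -mul_dsplit mulr_natl rmorphMn /=.
  by rewrite (rmorph_dsplit (intmul 1)).
move=> x y e; have en : n = (cd_degree x + cd_degree y + 2)%N.
  by rewrite /n -e !cd_degreeE; lia.
have ltk : ((cd_degree x).+1 < n.+1)%N by lia.
rewrite (bigD1 (Ordinal ltk)) //= big1 ?addr0 => [|k neq_k]; last first.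
  rewrite coefw_Phi_homog ?mulr0 ?mul0r //; apply: contra neq_k => /eqP ek.
  by apply/eqP/val_inj.
rewrite (@bin_factr n (cd_degree x).+1) // /ncoef.
have -> : (n - (cd_degree x).+1 = (cd_degree y).+1)%N by lia.
have h1 := factr_neq0 (cd_degree x).+1; have h2 := factr_neq0 (cd_degree y).+1.
by field; rewrite h1 h2.
Qed.

End FreeRing.

(** * Flags of the Boolean lattice *)

Lemma big_tuple_cons (R : Type) (idx : R) (op : Monoid.com_law idx)
    (T : finType) k (F : seq T -> R) :
  \big[op/idx]_(t : k.+1.-tuple T) F t =
    \big[op/idx]_z \big[op/idx]_(t : k.-tuple T) F (z :: t).
Proof.
rewrite pair_big_dep /=.
rewrite (reindex (fun p : T * k.-tuple T => [tuple of p.1 :: p.2])) //=.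
exists (fun t => (thead t, [tuple of behead t])) => [[z t] _ | t _] /=.
  by congr (_, _); apply: val_inj.
by rewrite [t in RHS]tuple_eta; apply: val_inj.
Qed.

Lemma big_tuple0 (R : Type) (idx : R) (op : Monoid.law idx) (T : finType) (F : seq T -> R) :
  \big[op/idx]_(t : 0.-tuple T) F t = F [::].
Proof.
rewrite (big_pred1 [tuple]) // => t /=.
by rewrite [t]tuple0; apply/esym/eqP.
Qed.

Fixpoint positions q (w : seq bool) : seq nat :=
  if w is x :: w' then
    if x then q :: positions q.+1 w' else positions q.+1 w'
  else [::].

(** For increasing sizes [s], the number of chains of subsets of [[n]] above a subset of size
    [p]. *)
Fixpoint flag_count n p (s : seq nat) : nat :=
  if s is q :: s' then 'C(n - p, q - p) * flag_count n q s' else 1.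

Section WordSums.
Context {R : nzRingType} (a b : R).

(** Flag numbers weighted by [b] at used ranks and [a - b] at the others; letters start at rank [q],
    above an element of rank [p]. *)
Definition wsum n p q r : R :=
  \sum_(t : r.-tuple bool)
     (\prod_(x <- t) (if x then b else a - b)) *+ flag_count n p (positions q t).

Lemma wsum0 n p q : wsum n p q 0 = 1.
Proof.
by rewrite /wsum (big_tuple0 _ (fun t => (\prod_(x <- t) _) *+ flag_count n p (positions q t))) big_nil.
Qed.

Lemma wsumS n p q r :
  wsum n p q r.+1 =
    (a - b) * wsum n p q.+1 r + (b * wsum n q q.+1 r) *+ 'C(n - p, q - p).
Proof.
rewrite /wsum (big_tuple_cons _ r (fun t => (\prod_(x <- t) _) *+ flag_count n p (positions q t))).
rewrite big_bool /= addrC; congr (_ + _).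
  rewrite mulr_sumr; apply: eq_bigr => t _.
  by rewrite big_cons mulrnAr.
rewrite mulr_sumr -sumrMnl; apply: eq_bigr => t _.
by rewrite big_cons mulrnAr -mulrnA mulnC.
Qed.

(** Upper intervals of a Boolean lattice are Boolean: only differences of ranks matter. *)
Lemma wsum_shift s n p q r : wsum (n + s) (p + s) (q + s) r = wsum n p q r.
Proof.
elim: r p q => [|r IHr] p q; first by rewrite !wsum0.
by rewrite !wsumS -addSn !IHr !subnDr.
Qed.

(** Words are sorted by their first [b], the lowest element of the flag. *)
Lemma wsum_unroll n p q r :
  wsum n p q r = (a - b) ^+ r
    + \sum_(i < r) ((a - b) ^+ i * b * wsum n (q + i) (q + i).+1 (r - i.+1)) *+
        'C(n - p, q + i - p).
Proof.
elim: r q => [|r IHr] q; first by rewrite wsum0 big_ord0 addr0.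
rewrite wsumS IHr mulrDr -exprS -addrA; congr (_ + _).
rewrite big_ord_recl expr0 mul1r addn0 subn1 addrC; congr (_ + _).
rewrite mulr_sumr; apply: eq_bigr => i _.
by rewrite mulrnAr lift0 -addSnnS subSS exprS !mulrA.
Qed.

Definition ab_series n := if n is n'.+1 then wsum n 0 1 n' else 0.

Lemma ab_series_fix :
  ab_series = egfD (egf_geom (a - b)) (egfM (egfr (egf_geom (a - b)) b) ab_series).
Proof.
apply: egf_eq => -[|n]; rewrite /egfD /egfM.
  by rewrite big_ord1 /= mulr0 mul0rn addr0.
rewrite [LHS]/= wsum_unroll; congr (_ + _).
rewrite big_ord_recl /egfr /= !mul0r mul0rn add0r big_ord_recr /= subnn mulr0 mul0rn addr0.
apply: eq_bigr => i _; rewrite /bump /= subn0 subSS.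
have lt_i := ltn_ord i.
have -> : (n - i = (n - i.+1).+1)%N by lia.
have := wsum_shift i.+1 (n - i.+1).+1 0 1 (n - i.+1).
have -> : ((n - i.+1).+1 + i.+1 = n.+1)%N by lia.
by rewrite /ab_series !add1n add0n => <-.
Qed.

End WordSums.

(** Expanding [a - b] at the positions outside [T] produces the sets [S] containing [T], with the
    signs of [flag_h]. *)
Lemma sum_signed_letters (R : nzRingType) (a b : R) r (f : {set 'I_r} -> int) :
  \sum_(S : {set 'I_r}) (\prod_(i < r) (if i \in S then b else a)) *~
      (\sum_(T : {set 'I_r} | T \subset S) (-1) ^+ #|S :\: T| * f T) =
  \sum_(T : {set 'I_r}) (\prod_(i < r) (if i \in T then b else a - b)) *~ f T.
Proof.
under eq_bigr do rewrite mulrz_sumr.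
rewrite (exchange_big_dep predT) //=; apply: eq_bigr => T _.
have prod0 (s : seq 'I_r) (F : 'I_r -> R) i : i \in s -> F i = 0 -> \prod_(j <- s) F j = 0.
  elim: s => // j s IHs; rewrite inE big_cons => /orP[/eqP <- -> | /IHs IH Fi].
    by rewrite mul0r.
  by rewrite IH ?mulr0.
have prodN (s : seq 'I_r) (F : 'I_r -> R) (p : pred 'I_r) :
    \prod_(j <- s) (if p j then - F j else F j) =
    (\prod_(j <- s) F j) *~ ((-1) ^+ \sum_(j <- s) p j).
  elim: s => [|j s IHs]; first by rewrite !big_nil.
  rewrite !big_cons IHs exprD mulrzA mulrzAr.
  by case: (p j); rewrite ?mulr1z ?mulrN1z ?mulNr.
(* [x] records whether [i] lies in [S]; the value 0 discards the sets [S] not containing [T]. *)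
pose F (i : 'I_r) x : R := if x then (if i \in T then b else - b) else (if i \in T then 0 else a).
have -> : \prod_(i < r) (if i \in T then b else a - b) = \prod_(i < r) \sum_(x : bool) F i x.
  by apply: eq_bigr => i _; rewrite big_bool /F; case: (i \in T) => /=; [rewrite addr0 | rewrite addrC].
rewrite bigA_distr_bigA /=.
rewrite (reindex (fun S : {set 'I_r} => [ffun i => i \in S])) /=; last first.
  exists (fun h : {ffun 'I_r -> bool} => [set i | h i]) => [S _ | h _].
    by apply/setP => i; rewrite inE ffunE.
  by apply/ffunP => i; rewrite ffunE inE.
rewrite -mulrzl mulr_sumr [RHS](bigID (fun S : {set 'I_r} => T \subset S)) /= [X in _ + X]big1 ?addr0.
  apply: eq_bigr => S sTS; rewrite mulrzl mulrzA; congr (_ *~ _).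
  rewrite (_ : #|S :\: T| = \sum_(i < r) (i \in S :\: T))%N; last first.
    by rewrite -sum1_card big_mkcond.
  rewrite -prodN; apply: eq_bigr => i _; rewrite ffunE /F in_setD.
  case: (boolP (i \in T)) => iT /=; first by rewrite (subsetP sTS).
  by case: (i \in S).
move=> S /subsetPn[i iT iS]; rewrite (prod0 _ _ i) ?mulr0 ?mem_index_enum //.
by rewrite ffunE (negPf iS) /F iT.
Qed.

Lemma positions_enum r (t : r.-tuple bool) :
  [seq (val i).+1 | i <- enum [set i | tnth t i]] = positions 1 t.
Proof.
have -> : enum [set i | tnth t i] = [seq i <- enum 'I_r | nth false t (val i)].
  rewrite enumT; apply: eq_filter => i.
  by rewrite !inE (tnth_nth false).
rewrite -[LHS]/(map (S \o val) _) map_comp.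
rewrite -(filter_map val (nth false t)) val_enum_ord -[r in iota 0 r](size_tuple t).
move: (tval t) => w {t}.
have gen q : [seq i.+1 | i <- iota q (size w) & nth false w (i - q)] = positions q.+1 w.
  elim: w q => [|x w IHw] q //=; rewrite subnn.
  have e : [seq i <- iota q.+1 (size w) | nth false (x :: w) (i - q)]
           = [seq i <- iota q.+1 (size w) | nth false w (i - q.+1)].
    apply: eq_in_filter => i; rewrite mem_iota => /andP[lt_q _].
    by have -> : (i - q = (i - q.+1).+1)%N by lia.
  by case: x e => /= e; rewrite e IHw.
by rewrite -gen; congr map; apply: eq_filter => i; rewrite subn0.
Qed.

(** * Ranks and chains of subsets *)

Lemma le_boolean n (x y : boolean_lattice n) : (x <= y)%O = (x \subset y).
Proof. by []. Qed.

Lemma lt_boolean n (x y : boolean_lattice n) : (x < y)%O = (x \proper y).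
Proof. by rewrite lt_leAnge !le_boolean properE. Qed.

(** Initial segments of an enumeration of [x] form a chain of [#|x| + 1] sets; no chain is longer,
    since cardinality is injective on chains. *)
Lemma rank_boolean n (x : boolean_lattice n) : rank x = #|x|.
Proof.
have chainC k : (k <= #|x|)%N -> #|[set y in take k (enum x)]| = k.
  move=> le_k; rewrite cardsE; have /card_uniqP -> : uniq (take k (enum x)).
    by rewrite take_uniq ?enum_uniq.
  by rewrite size_takel // -cardE.
have subC k l : (k <= l)%N ->
    [set y in take k (enum x)] \subset [set y in take l (enum x)].
  move=> le_kl; apply/subsetP => y; rewrite !inE => yk.
  by move: yk; rewrite -{1}(subnKC le_kl) takeD mem_cat => ->.
pose C := [set [set y in take (val k) (enum x)] | k : 'I_#|x|.+1].
have cardC : #|C| = #|x|.+1.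
  rewrite card_imset ?card_ord // => k l /(congr1 (fun A : {set _} => #|A|)).
  by rewrite !chainC -1?ltnS ?ltn_ord // => /val_inj.
rewrite /rank; set m := (\max_(_ | _) _); suff -> : m = #|x|.+1 by [].
apply/eqP; rewrite eqn_leq; apply/andP; split; last first.
  rewrite -cardC; apply: (leq_bigmax_cond (F := fun D : {set {set 'I_n}} => #|D|)).
  apply/andP; split.
    apply/forall_inP => y /imsetP[k _ ->]; rewrite le_boolean.
    by apply/subsetP => z; rewrite inE => /mem_take; rewrite mem_enum.
  apply/forall_inP => y /imsetP[k _ ->]; apply/forall_inP => z /imsetP[l _ ->].
  rewrite /Order.comparable !le_boolean; apply/orP.
  by case: (leqP k l) => [|/ltnW] /subC; [left | right].
apply/bigmax_leqP => D /andP[/forall_inP Dx /forall_inP Dc].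
rewrite cardE -(size_map (fun y : {set 'I_n} => #|y|)) -(size_iota 0 #|x|.+1).
apply: uniq_leq_size => [|k /mapP[y]]; last first.
  rewrite mem_enum => /Dx; rewrite le_boolean => /subset_leq_card le_y ->.
  by rewrite mem_iota /= add0n ltnS.
rewrite map_inj_in_uniq ?enum_uniq // => y z; rewrite !mem_enum => yD zD eq_yz.
have /forall_inP/(_ z zD) := Dc y yD; rewrite /Order.comparable !le_boolean => /orP[] s_yz.
  by apply/eqP; rewrite eqEcard s_yz eq_yz leqnn.
by apply/esym/eqP; rewrite eqEcard s_yz eq_yz leqnn.
Qed.

Lemma card_proper_supersets n (y : {set 'I_n}) r : (#|y| < r)%N ->
  #|[set z : {set 'I_n} | y \proper z & #|z| == r]| = 'C(n - #|y|, r - #|y|).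
Proof.
move=> lt_yr.
have -> : (n - #|y| = #|~: y|)%N by rewrite [RHS]cardsCs setCK card_ord.
rewrite -cards_draws.
have -> : [set z : {set 'I_n} | y \proper z & #|z| == r] =
    (fun B => y :|: B) @: [set B : {set 'I_n} | B \subset ~: y & #|B| == (r - #|y|)%N].
  apply/setP => z; rewrite inE; apply/andP/imsetP => [[yz /eqP zr] | [B]].
    exists (z :\: y); last by rewrite setDE setUIr setUCr setIT; apply/esym/setUidPr/proper_sub.
    by rewrite inE subDset setUCr subsetT cardsDS ?proper_sub // zr eqxx.
  rewrite inE => /andP[sB /eqP cB] ->.
  have cU : #|y :|: B| = r.
    rewrite cardsU (_ : y :&: B = set0); first by rewrite cards0 subn0 cB subnKC // ltnW.
    by apply/eqP; rewrite setI_eq0 disjoint_sym disjoints_subset.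
  by rewrite cU eqxx properEcard subsetUl cU.
rewrite card_in_imset // => B B'; rewrite !inE => /andP[sB _] /andP[sB' _] eqU.
have : (y :|: B) :\: y = (y :|: B') :\: y by rewrite eqU.
rewrite !setDUl !setDv !set0U !setDE.
by rewrite (setIidPl sB) (setIidPl sB').
Qed.

(** The number of continuations depends only on the size of the first element, so the count is a
    product. *)
Lemma count_chains n k (s : seq nat) (y : boolean_lattice n) :
    size s = k -> path ltn #|y| (rcons s n) ->
  (\sum_(t : k.-tuple (boolean_lattice n))
     (path <%O y (rcons t \top%O) && ([seq rank z | z <- t] == s)))%N = flag_count n #|y| s.
Proof.
elim: k s y => [|k IHk] [|r s] y //= sz.
  move=> /andP[lt_n _].
  rewrite (big_tuple0 _ (fun t => nat_of_bool (path <%O y (rcons t \top%O) && ([seq rank z | z <- t] == [::])))) /=.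
  by rewrite !andbT lt_boolean -[\top%O]/[set: 'I_n] properEcard subsetT cardsT card_ord lt_n.
move=> /andP[lt_r pth].
rewrite (big_tuple_cons _ k (fun t => nat_of_bool
  (path <%O y (rcons t \top%O) && ([seq rank z | z <- t] == r :: s)))) /=.
rewrite (bigID (fun z : boolean_lattice n => (y < z)%O && (rank z == r))) /=.
rewrite [X in (_ + X)%N]big1 ?addn0 => [|z nz]; last first.
  rewrite big1 // => t _; rewrite eqseq_cons; apply/eqP; rewrite eqb0.
  by apply: contra nz => /andP[/andP[-> _] /andP[-> _]].
rewrite (eq_bigr (fun _ => flag_count n r s)) => [|z /andP[lt_yz /eqP rz]].
  rewrite sum_nat_const; congr (_ * _)%N.
  rewrite -card_proper_supersets // -sum1_card -sum1_card; apply: eq_bigl => z.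
  by rewrite [RHS]inE unfold_in lt_boolean rank_boolean.
rewrite rank_boolean in rz; rewrite -[r in RHS]rz -IHk ?rz //; last by case: sz.
by apply: eq_bigr => t _; rewrite eqseq_cons lt_yz rank_boolean rz eqxx.
Qed.

Lemma path_positions p q w : (p < q)%N -> path ltn p (rcons (positions q w) (q + size w)%N).
Proof.
elim: w p q => [|x w IHw] p q lt_pq; first by rewrite /= addn0 andbT.
rewrite [size _]/= -addSnnS; case: x => /=; first by rewrite lt_pq IHw.
by apply: IHw; apply: ltnW.
Qed.

Lemma flag_f_boolean r (t : r.-tuple bool) :
  flag_f (P := boolean_lattice r.+1) [set i | tnth t i] = flag_count r.+1 0 (positions 1 t).
Proof.
have sz : #|[set i | tnth t i]| = size (positions 1 t).
  by rewrite -positions_enum size_map cardE.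
have := @count_chains r.+1 _ (positions 1 t) set0 (esym sz); rewrite cards0 => <-.
  rewrite /flag_f -sum1_card big_mkcond /=; apply: eq_bigr => x _.
  by rewrite inE positions_enum; case: (_ && _).
by have := @path_positions 0 1 t isT; rewrite size_tuple.
Qed.


Lemma ab_indexE disp (P : finTBPOrderType disp) r : (rank (\top%O : P)).-1 = r ->
  ab_index P = \sum_(S : {set 'I_r}) flag_h (P := P) S *: \prod_(i < r) ncvar (i \in S).
Proof. by move=> <-. Qed.

Lemma ab_index_boolean n :
  ab_index (boolean_lattice n.+1) = ab_series (ncvar false) (ncvar true) n.+1.
Proof.
rewrite (@ab_indexE _ _ n); last by rewrite rank_boolean -[\top%O]/[set: 'I_n.+1] cardsT card_ord.
transitivity (\sum_(S : {set 'I_n}) (\prod_(i < n) (if i \in S then ncvar true else ncvar false))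
    *~ flag_h (P := boolean_lattice n.+1) S).
  apply: eq_bigr => S _; rewrite -scaler_int intz; congr (_ *: _).
  by apply: eq_bigr => i _; case: (i \in S).
rewrite sum_signed_letters /ab_series /wsum.
rewrite (reindex (fun t : n.-tuple bool => [set i | tnth t i])) /=; last first.
  exists (fun S : {set 'I_n} => [tuple i \in S | i < n]) => [t _ | S _].
    by apply: eq_from_tnth => i; rewrite tnth_mktuple inE.
  by apply/setP => i; rewrite inE tnth_mktuple.
apply: eq_bigr => t _; rewrite flag_f_boolean; congr (_ *+ _).
by rewrite big_tuple; apply: eq_bigr => i _; rewrite inE.
Qed.

(** * The concrete free ring and the recursion for the Boolean cd-index *)

Definition ncmon (w : seq bool) : ncpoly := << FMonom w >>.

Lemma ncmonM u v : ncmon u * ncmon v = ncmon (u ++ v).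
Proof.
by rewrite /ncmon malgM_def fgmulUU mulr1; congr mkmalgU; apply: fmmulE.
Qed.

Lemma ncmon_nil : ncmon [::] = 1.
Proof. by apply/malgP => k; rewrite mcoeffU1 mcoeff1 eq_sym -fmoneE. Qed.

Lemma ncpoly_ind (P : ncpoly -> Prop) :
    P 0 -> (forall F G, P F -> P G -> P (F + G)) -> (forall F, P F -> P (- F)) ->
    (forall w, P (ncmon w)) -> forall F, P F.
Proof.
move=> P0 PD PN Pm F; rewrite [F]monalgE; apply: (big_ind P) => // k _.
have Pn n : P (<< n%:Z *g k >>).
  elim: n => [|n IHn]; first by rewrite monalgU0.
  rewrite -addn1 PoszD monalgUD; apply: PD => //.
  by case: k {IHn} => w; apply: Pm.
case: (F@_k) => n; first exact: Pn.
by rewrite NegzE monalgUN; apply/PN/Pn.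
Qed.

Definition ncext (h : seq bool -> ncpoly) (F : ncpoly) : ncpoly :=
  mmap (intmul (1 : ncpoly)) (fun w : {fmonom bool} => h w) F.

Lemma ncextB h : {morph ncext h : F G / F - G}.
Proof. exact: (@mmapB {fmonom bool} int ncpoly (intmul (1 : ncpoly)) (fun w => h w)). Qed.

Lemma ncext_mon h w : ncext h (ncmon w) = h w.
Proof.
have := @mmapU {fmonom bool} int ncpoly (intmul (1 : ncpoly)) (fun w => h w) 1 (FMonom w).
by rewrite mul1r.
Qed.

Definition nccoef (F : ncpoly) (w : seq bool) : int := F@_(FMonom w).

Lemma nccoefB w : {morph nccoef^~ w : F G / F - G}.
Proof. by move=> F G; apply: mcoeffB. Qed.

Lemma nccoef_mon u w : nccoef (ncmon u) w = (u == w)%:R.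
Proof. by rewrite /nccoef /ncmon mcoeffU1 fmP. Qed.

Lemma nccoef_eq F G : nccoef F =1 nccoef G -> F = G.
Proof. by move=> eqFG; apply/malgP => -[w]; apply: eqFG. Qed.

Lemma cd_evalE F : cd_eval F = cdev ncmon ncext F.
Proof.
rewrite /cd_eval /cdev /ncext mmapE; apply: eq_bigr => w _ /=.
by rewrite mulrzl -scaler_int intz.
Qed.

(** The value 0 at index 0 matches the constant term of [ab_series]. *)
Definition cd_boolean n := if n is 0%N then 0 else cd_index (boolean_lattice n).

Lemma cd_eval_boolean n :
  cdev ncmon ncext (cd_boolean n) = ab_series (ncvar false) (ncvar true) n.
Proof.
have X_fix := ab_series_fix (ncvar false) (ncvar true).
case: n => [|n]; first exact: (cdev0 ncmon ncextB).
rewrite -cd_evalE -ab_index_boolean.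
apply: (epsilon_spec (inhabits (0 : ncpoly))
  (fun F => cd_eval F = ab_index (boolean_lattice n.+1))).
have [F eF] := cdev_exists ncmonM ncmon_nil ncpoly_ind ncextB ncext_mon X_fix n.+1.
by exists F; rewrite cd_evalE ab_index_boolean.
Qed.

Definition nbeta (v : seq bool) : rat :=
  (cd_coef_boolean v)%:~R / ((cd_degree v).+1)`!%:R.

Lemma nbeta_rec v :
  2 * (cd_degree v).+1%:R * nbeta v =
    (if v is [::] then 2 else 0) + lstrip nbeta v + rstrip nbeta v + dsplit nbeta nbeta v.
Proof.
exact: (ncoef_rec ncmonM ncmon_nil ncpoly_ind ncextB ncext_mon nccoefB nccoef_mon
  nccoef_eq (ab_series_fix (ncvar false) (ncvar true)) cd_eval_boolean v).
Qed.

(** * From words to lists *)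

Lemma cd_word_cons p s : s != [::] -> cd_word (p :: s) = nseq p false ++ true :: cd_word s.
Proof. by case: s. Qed.

Lemma cd_word_cat M N : M != [::] -> N != [::] ->
  cd_word (M ++ N) = cd_word M ++ true :: cd_word N.
Proof.
elim: M => // p M IHM _ Nn; have [-> | Mn] := eqVneq M [::].
  by rewrite cat1s cd_word_cons.
rewrite cat_cons !cd_word_cons ?IHM -?catA //.
by case: M Mn {IHM}.
Qed.

Lemma beta_lt s t : cd_degree (cd_word s) = cd_degree (cd_word t) ->
  (beta s < beta t) = (nbeta (cd_word s) < nbeta (cd_word t)).
Proof.
move=> e; rewrite /nbeta e ltr_pM2r ?ltr_int // invr_gt0 ltr0n.
exact: fact_gt0.
Qed.

Lemma beta_le s t : cd_degree (cd_word s) = cd_degree (cd_word t) ->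
  (beta s <= beta t) = (nbeta (cd_word s) <= nbeta (cd_word t)).
Proof.
move=> e; rewrite /nbeta e ler_pM2r ?ler_int // invr_gt0 ltr0n.
exact: fact_gt0.
Qed.

Lemma cd_word2 p q : cd_word [:: p; q] = nseq p false ++ true :: nseq q false.
Proof. by []. Qed.

Theorem theorem7p3 (m n m1 n1 m2 n2 : nat) (M N : seq nat)
    (hmn : (m < n)%N)
    (hsum : (m1 + n1 = m2 + n2)%N)
    (hdiff : (`|m1%:Z - n1%:Z| < `|m2%:Z - n2%:Z|)%R) :
  ((beta (M ++ [:: m; n]) >= beta (M ++ [:: n; m]))%R /\
   (M = [::] -> beta (M ++ [:: m; n]) = beta (M ++ [:: n; m]))) /\
  (beta (M ++ [:: m1; n1] ++ N) > beta (M ++ [:: m2; n2] ++ N))%R.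
Proof.
(* For a fixed sum, a smaller difference is a larger minimum. *)
have lt_min : (minn m2 n2 < minn m1 n1)%N by lia.
have eq0 : nbeta (cd_word [:: m; n]) = nbeta (cd_word [:: n; m]).
  by rewrite -(b_rev nbeta_rec) !cd_word2 rev_cat rev_cons !rev_nseq cat_rcons.
have deg_swap p q : cd_degree (cd_word [:: p; q]) = (p + q + 2)%N.
  by rewrite cd_word2 !cd_degreeE; lia.
have eq0' : beta [:: m; n] = beta [:: n; m].
  by apply/eqP; rewrite eq_le !beta_le ?eq0 ?lexx // !deg_swap addnAC; lia.
split; last first.
  have [-> | Mn] := eqVneq M [::]; have [-> | Nn] := eqVneq N [::].
  - rewrite !cats0 !cat0s beta_lt ?deg_swap ?hsum //.
    exact: (one_d_order nbeta_rec).
  - rewrite !cat0s beta_lt ?cd_word_cat //; last by rewrite !cd_degreeE; lia.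
    rewrite !cd_word2 -!catA /=; exact: (b_cdcd_order nbeta_rec).
  (* Reversal brings the pair to the front and swaps its exponents, which keeps the minimum. *)
  - rewrite !cats0 beta_lt ?cd_word_cat //; last by rewrite !cd_degreeE; lia.
    rewrite !cd_word2 !(b_cdcd_rev nbeta_rec); apply: (b_cdcd_order nbeta_rec); lia.
  - rewrite !catA beta_lt -!catA ?cd_word_cat //; last by rewrite !cd_degreeE; lia.
    rewrite !cd_word2 -!catA /=; exact: (b_dcdcd_order nbeta_rec).
split; last by move=> ->.
have [-> | Mn] := eqVneq M [::]; first by rewrite !cat0s eq0'.
rewrite beta_le ?cd_word_cat //; last by rewrite !cd_degreeE; lia.
(* After reversal the claim compares [b_cdcd m n] with [b_cdcd n m]. *)
by rewrite !cd_word2 !(b_cdcd_rev nbeta_rec); apply: (b_cdcd_flip nbeta_rec).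
Qed.
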